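(* Let $G$ be a group of order $27$. Then $G$ is Cay-DS if and only if $G\cong C_{27}$.
   Context: For a finite group $G$ and a subset $S\subseteq G\setminus\{1\}$ with $S=S^{-1}$, the Cayley graph $Cay(G,S)$ has vertex set $G$, with $a,b$ adjacent iff $ab^{-1}\in S$. The spectrum of a graph is the multiset of eigenvalues of its adjacency matrix. A finite group $G$ is Cay-DS if every Cayley graph $\Gamma$ on $G$ is isomorphic to every Cayley graph $\Gamma'$ (on any finite group) with the same spectrum as $\Gamma$. $C_n$ is the cyclic group of order $n$. *)

(* Defs.v *)
From mathcomp Require Import all_boot all_algebra all_fingroup all_field.

Set Implicit Arguments.
Unset Strict Implicit.
Unset Printing Implicit Defensive.

Import GRing.Theory.

Local Open Scope ring_scope.

Definition adjacency_mx (V : finType) (e : rel V) : 'M[algC]_#|V| :=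
  \matrix_(i, j) (e (enum_val i) (enum_val j))%:R.

(* The eigenvalues of A listed with algebraic multiplicity, in an unspecified *)
(* order: a sequence r with char_poly A = \prod_(z <- r) ('X - z%:P).         *)
Definition spectrum (n : nat) (A : 'M[algC]_n) : seq algC :=
  sval (closed_field_poly_normal (char_poly A)).

Definition cospectral (V W : finType) (e : rel V) (f : rel W) : Prop :=
  perm_eq (spectrum (adjacency_mx e)) (spectrum (adjacency_mx f)).

Definition graph_iso (V W : finType) (e : rel V) (f : rel W) : Prop :=
  exists2 phi : V -> W, bijective phi & forall x y, f (phi x) (phi y) = e x y.

Local Open Scope group_scope.

Definition connection_set (gT : finGroupType) (S : {set gT}) : Prop :=
  1 \notin S /\ S^-1 = S.

Definition Cay (gT : finGroupType) (S : {set gT}) : rel gT :=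
  [rel a b | a * b^-1 \in S].

Definition CayDS (gT : finGroupType) : Prop :=
  forall S : {set gT}, connection_set S ->
  forall (hT : finGroupType) (S' : {set hT}), connection_set S' ->
  cospectral (Cay S) (Cay S') -> graph_iso (Cay S) (Cay S').

(* Main.v *)
(* The spectrum of a Cayley graph determines its numbers of closed walks, and *)
(* its eigenvalues are those of blocks cut out by characters.                 *)
(*                                                                            *)
(* Noncyclic groups: two pairs of cospectral nonisomorphic Cayley graphs      *)
(* serve all four of them, one of degree 6 containing the Hamming graph       *)
(* H(3, 3) and one of degree 10 on C9 x C3.                                   *)
(*                                                                            *)
(* The cyclic group: let Cay(H, S') be cospectral with Cay(C27, S) and let    *)
(* lambda be the sum of zeta^s for s in S, with zeta a primitive 27-th root   *)
(* of unity.                                                                  *)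
(* - If H is noncyclic, it contains an elementary abelian subgroup of index   *)
(*   3, so lambda is a root of a cubic polynomial over Q(zeta^9); hence       *)
(*   lambda is fixed by zeta |-> zeta^10, and S is a union of <9>-cosets      *)
(*   outside <3>.  Such "fibred" S give 32 graphs, which are recognised among *)
(*   all Cayley graphs of noncyclic groups of order 27, and among the fibred  *)
(*   ones of C27, by their closed walks of length 2, 3 and 4.                 *)
(* - If H is cyclic and S is not fibred, lambda is the eigenvalue of S' at a  *)
(*   primitive character; after a power map S and S' only differ by full      *)
(*   <9>-cosets, and closed walks of length at most 4 force S = S'.           *)

From Stdlib Require Import NArith.
From HB Require Import structures.
Require Import Defs.
From mathcomp Require Import all_boot all_order all_algebra all_fingroup.
From mathcomp Require Import all_solvable all_field.

Set Implicit Arguments.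
Unset Strict Implicit.
Unset Printing Implicit Defensive.

Import Order.TTheory GRing.Theory Num.Theory.

(** * Closed walks and the spectrum *)

(** The power sums of a spectrum are the numbers of closed walks ([cospectral_walks]), and by
    translation these can be counted at the identity alone.

    On C27, the eigenvalue of [S] at a primitive character is a sum of powers of zeta, and all
    rational relations among these powers come from 1 + zeta^9 + zeta^18 = 0 ([zeta_free]). So two
    sets with the same such eigenvalue differ only by entire cosets of <9>.

    If the mate lives on a noncyclic group, the automorphism sigma : zeta |-> zeta^4 fixes the cubic
    of [nc_spectrum_cubic]. The orbit of the eigenvalue has length dividing 9 and at most 3, so
    sigma^3 fixes it ([cubic_orbit]), which makes [S] fibred ([fixed_fibred]). For fibred sets,
    short closed walks decide the isomorphism class, by exhaustive search ([fibred_key],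
    [C27_rigid], [nc_rigid]). If both groups are cyclic and [S] is not fibred, a power map arranges
    equal eigenvalues at the same primitive character, and short walks exclude any exchange of
    cosets ([flip_cosets_id]).

    Conversely, a noncyclic group of order 27 has one of four explicit multiplications
    ([noncyclic_coded]), and [nc_not_CayDS] gives each a cospectral nonisomorphic pair.
    Cospectrality is certified by a common annihilating polynomial and finitely many closed-walk
    numbers ([walks_cospectral]), nonisomorphism by a walk number occurring in only one of the
    graphs. *)

Section Walks.

Variable V : finType.
Implicit Type e : rel V.

Fixpoint walks e k (x y : V) : nat :=
  if k is k'.+1 then \sum_z e x z * walks e k' z y else x == y.

Lemma walksD e k l x y :
  walks e (k + l) x y = \sum_z walks e k x z * walks e l z y.
Proof.
elim: k x => [|k IH] x /=.
  rewrite (bigD1 x) //= eqxx mul1n big1 ?addn0 // => z; rewrite eq_sym.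
  by case: eqP.
under eq_bigr => z _ do rewrite IH big_distrr /=.
rewrite exchange_big /=; apply: eq_bigr => t _.
by rewrite big_distrl /=; apply: eq_bigr => z _; rewrite mulnA.
Qed.

Lemma walks1 e x y : walks e 1 x y = e x y.
Proof.
rewrite /= (bigD1 y) //= eqxx muln1 big1 ?addn0 // => z /negPf->.
by rewrite muln0.
Qed.

Lemma walks_sym e k x y : symmetric e -> walks e k x y = walks e k y x.
Proof.
move=> sym_e; elim: k x y => [|k IH] x y; first by rewrite /= eq_sym.
rewrite -[in RHS]addn1 walksD; apply: eq_bigr => z _.
by rewrite walks1 IH sym_e mulnC.
Qed.

Local Open Scope ring_scope.

(** The entries of A^k count walks; the cast to size [n.+1] provides the matrix ring that
    [horner_mx] works in. *)
Lemma horner_mx_adjacency e n (eqn : #|V| = n.+1) (p : {poly algC}) i j :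
  horner_mx (castmx (eqn, eqn) (adjacency_mx e)) p i j
  = \sum_(k < size p)
      p`_k * (walks e k (enum_val (cast_ord (esym eqn) i))
                        (enum_val (cast_ord (esym eqn) j)))%:R.
Proof.
set A := castmx _ _; pose f (i : 'I_n.+1) := enum_val (cast_ord (esym eqn) i).
have fB : bijective f.
  exists (fun x => cast_ord eqn (enum_rank x)) => x.
    by rewrite /f enum_valK cast_ordKV.
  by rewrite /f cast_ordK enum_rankK.
have Ak k a b : (A ^+ k) a b = (walks e k (f a) (f b))%:R.
  elim: k a b => [|k IH] a b.
    by rewrite expr0 mxE /= (inj_eq (bij_inj fB)).
  rewrite exprS mxE /= (reindex f) /=; last exact: onW_bij.
  rewrite natr_sum; apply: eq_bigr => c _.
  by rewrite IH natrM castmxE mxE.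
rewrite -[p in LHS]coefK poly_def rmorph_sum summxE /=.
apply: eq_bigr => k _.
by rewrite linearZ rmorphXn /= horner_mx_X mxE Ak.
Qed.

End Walks.

(** * Power sums of the spectrum and annihilating polynomials *)

Section Spectrum.

Local Open Scope ring_scope.

Lemma spectrumE n (A : 'M[algC]_n) :
  char_poly A = \prod_(z <- spectrum A) ('X - z%:P).
Proof.
rewrite /spectrum; case: closed_field_poly_normal => r /= {1}->.
by rewrite (monicP (char_poly_monic A)) scale1r.
Qed.

Lemma char_poly_conjmx n (P A : 'M[algC]_n) :
  P \in unitmx -> char_poly (conjmx P A) = char_poly A.
Proof.
move=> Pu; pose f := map_mx (@polyC algC).
have PP : f n n P *m f n n (invmx P) = 1%:M by rewrite -map_mxM mulmxV // map_mx1.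
have -> : char_poly (conjmx P A)
    = \det (f n n P *m char_poly_mx A *m f n n (invmx P)).
  congr (\det _); rewrite /char_poly_mx mulmxBr mulmxBl.
  rewrite [f n n P *m 'X%:M]scalar_mxC -(mulmxA 'X%:M) PP mulmx1; congr (_ - _).
  by rewrite conjumx // map_mxM map_mxM.
by rewrite !det_mulmx mulrAC -det_mulmx PP det1 mul1r.
Qed.

Lemma trig_mxM n (A B : 'M[algC]_n) : is_trig_mx A -> is_trig_mx B ->
  is_trig_mx (A *m B) /\ forall i, (A *m B) i i = A i i * B i i.
Proof.
move=> /is_trig_mxP tA /is_trig_mxP tB; split=> [|i].
  apply/is_trig_mxP => i j ij; rewrite mxE big1 // => k _.
  by case: (ltnP i k) => [/tA->|ki]; rewrite ?mul0r // tB ?mulr0 // (leq_ltn_trans ki).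
rewrite mxE (bigD1 i) //= big1 ?addr0 // => k; rewrite -val_eqE neq_ltn /=.
by case/orP => [/tB|/tA] ->; rewrite ?mulr0 ?mul0r.
Qed.

Lemma horner_mx_trig n (A : 'M[algC]_n.+1) (p : {poly algC}) i :
  is_trig_mx A -> horner_mx A p i i = p.[A i i].
Proof.
move=> tA; suff [] : is_trig_mx (horner_mx A p)
    /\ forall i, horner_mx A p i i = p.[A i i] by move=> _ ->.
elim/poly_ind: p => [|p c [tp dp]].
  by split=> [|j]; rewrite rmorph0 ?mx0_is_trig // mxE horner0.
have [tpA dpA] := trig_mxM tp tA.
rewrite rmorphD rmorphM /= horner_mx_X horner_mx_C; split=> [|j].
  apply/is_trig_mxP => a b ab; rewrite mxE (is_trig_mxP tpA) //.
  by rewrite (is_trig_mxP (scalar_mx_is_trig _ _)) ?addr0.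
by rewrite mxE dpA dp hornerMXaddC [_%:M _ _]mxE eqxx.
Qed.

(** By Schur, [A] is similar to a triangular matrix, whose diagonal lists the eigenvalues with
    multiplicity; the diagonal of p(A) is then p of that diagonal. *)
Lemma trace_horner_spectrum n (A : 'M[algC]_n.+1) (p : {poly algC}) :
  \tr (horner_mx A p) = \sum_(z <- spectrum A) p.[z].
Proof.
have [P Pun] := Schur A (ltn0Sn n).
rewrite /similar_to; set B := conjmx P A => trigB.
have Pu : P \in unitmx by apply: unitarymx_unit.
have -> : spectrum A = spectrum B by rewrite /spectrum char_poly_conjmx.
have -> : \tr (horner_mx A p) = \tr (horner_mx B p).
  rewrite horner_mx_conj ?row_free_unit // ?stablemx_unit //.
  by rewrite conjumx // -mulmxA mxtrace_mulC mulmxKV.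
have /prod_XsubC_eq eqB : \prod_(z <- spectrum B) ('X - z%:P)
    = \prod_(z <- [seq B i i | i <- index_enum 'I_n.+1]) ('X - z%:P).
  by rewrite -spectrumE (char_poly_trig trigB) big_map.
by rewrite (perm_big _ eqB) /= big_map; apply: eq_bigr => i _; rewrite horner_mx_trig.
Qed.

Lemma spectrum_castmx m n (eq_mn : m = n) (A : 'M[algC]_m) :
  spectrum (castmx (eq_mn, eq_mn) A) = spectrum A.
Proof. by case: n / eq_mn. Qed.

Lemma sum_spectrum_walks (V : finType) (e : rel V) (p : {poly algC}) :
  (0 < #|V|)%N ->
  \sum_(z <- spectrum (adjacency_mx e)) p.[z]
  = \sum_(k < size p) p`_k * (\sum_x walks e k x x)%:R.
Proof.
move=> /prednK/esym eqn; rewrite -(spectrum_castmx eqn) -trace_horner_spectrum.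
rewrite /mxtrace; under eq_bigr do rewrite horner_mx_adjacency.
rewrite exchange_big /=; apply: eq_bigr => k _.
rewrite -mulr_sumr -natr_sum; congr (_ * _%:R).
rewrite [RHS](reindex (fun i => enum_val (cast_ord (esym eqn) i))) //=.
apply: onW_bij; exists (fun x => cast_ord eqn (enum_rank x)) => x.
  by rewrite enum_valK cast_ordKV.
by rewrite cast_ordK enum_rankK.
Qed.

Lemma cospectral_card (V W : finType) (e : rel V) (f : rel W) :
  cospectral e f -> #|V| = #|W|.
Proof.
move/perm_size; have szE n (A : 'M[algC]_n) : size (spectrum A) = n.
  by apply: succn_inj; rewrite -(size_char_poly A) spectrumE size_prod_XsubC.
by rewrite !szE.
Qed.

Lemma cospectral_walks (V W : finType) (e : rel V) (f : rel W) k :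
  (0 < #|V|)%N -> cospectral e f ->
  (\sum_x walks e k x x = \sum_y walks f k y y)%N.
Proof.
move=> V0 ef; have W0 := V0; rewrite (cospectral_card ef) in W0.
have : \sum_(z <- spectrum (adjacency_mx e)) 'X^k.[z]
     = \sum_(z <- spectrum (adjacency_mx f)) 'X^k.[z] by apply: perm_big.
have aux (g : nat -> nat) :
    \sum_(i < k.+1) ('X^k : {poly algC})`_i * (g i)%:R = (g k)%:R.
  rewrite big_ord_recr /= coefXn eqxx mul1r big1 ?add0r // => i _.
  by rewrite coefXn ltn_eqF ?mul0r.
rewrite !sum_spectrum_walks // size_polyXn.
rewrite (aux (fun i => \sum_x walks e i x x)%N).
by rewrite (aux (fun i => \sum_x walks f i x x)%N) => /eqP; rewrite eqr_nat => /eqP.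
Qed.

Lemma root_spectrum n (A : 'M[algC]_n.+1) (q : {poly algC}) z :
  horner_mx A q = 0 -> z \in spectrum A -> root q z.
Proof.
move=> qA; rewrite -root_prod_XsubC -spectrumE -eigenvalue_root_char.
case/eigenvalueP => v vA v0; rewrite /root.
have: v *m horner_mx A q = q.[z] *: v.
  elim/poly_ind: {qA}q => [|q c IH]; first by rewrite rmorph0 mulmx0 horner0 scale0r.
  rewrite rmorphD rmorphM /= horner_mx_X horner_mx_C mulmxDr mulmxA IH.
  by rewrite -scalemxAl vA hornerMXaddC mul_mx_scalar scalerA -scalerDl.
by rewrite qA mulmx0 => /esym/eqP; rewrite scaler_eq0 (negPf v0) orbF.
Qed.

(* On the at most [size q - 1] eigenvalues, all of them roots of [q], the     *)
(* multiplicities are recovered from the power sums by Lagrange interpolation. *)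
Lemma walks_cospectral (V W : finType) (e : rel V) (f : rel W)
    (q : {poly algC}) :
  q != 0 -> (0 < #|V|)%N -> #|V| = #|W| ->
  (forall x y, \sum_(k < size q) q`_k * (walks e k x y)%:R = 0) ->
  (forall x y, \sum_(k < size q) q`_k * (walks f k x y)%:R = 0) ->
  (forall k, (k < size q)%N ->
     (\sum_x walks e k x x = \sum_y walks f k y y)%N) ->
  cospectral e f.
Proof.
move=> q0 V0 VW qe qf ef; have W0 := V0; rewrite VW in W0.
have sub (U : finType) (g : rel U) : (0 < #|U|)%N ->
  (forall x y, \sum_(k < size q) q`_k * (walks g k x y)%:R = 0) ->
  forall z, z \in spectrum (adjacency_mx g) -> root q z.
  move=> /prednK/esym eqn qg z; rewrite -(spectrum_castmx eqn).
  apply: root_spectrum; apply/matrixP => i j.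
  by rewrite horner_mx_adjacency qg mxE.
rewrite /cospectral; set r := spectrum _; set s := spectrum _; pose u := undup (r ++ s).
have uq : (size u < size q)%N.
  apply: max_poly_roots; rewrite ?undup_uniq //.
  by apply/allP => z; rewrite mem_undup mem_cat => /orP[]; apply: sub.
have sumE (p : {poly algC}) : (size p <= size q)%N ->
    \sum_(z <- r) p.[z] = \sum_(z <- s) p.[z].
  move=> pq; rewrite !sum_spectrum_walks //; apply: eq_bigr => k _.
  by rewrite ef // (leq_trans (ltn_ord k)).
(* [p] vanishes at every eigenvalue of either graph except [z], so its sum over a spectrum is p(z)
   times the multiplicity of [z]. *)
apply/allP => z zrs /=; pose p := \prod_(t <- rem z u) ('X - t%:P).
have zu : z \in u by rewrite mem_undup.
have pz : p.[z] != 0.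
  by rewrite -[_ == 0]/(root p z) root_prod_XsubC mem_rem_uniqF ?undup_uniq.
have pE (l : seq algC) : {subset l <= u} ->
    \sum_(t <- l) p.[t] = p.[z] *+ count_mem z l.
  elim: l => [|t l IH] lu; first by rewrite big_nil.
  rewrite big_cons IH /=; last by move=> a al; rewrite lu // inE al orbT.
  case: eqP => [->|/eqP tz]; first by rewrite add1n mulrS.
  rewrite add0n (_ : p.[t] = 0) ?add0r //.
  apply/eqP; rewrite -[_ == 0]/(root p t) root_prod_XsubC mem_rem_uniq ?undup_uniq //.
  by rewrite !inE tz lu ?mem_head.
have pq : (size p <= size q)%N.
  rewrite size_prod_XsubC size_rem // prednK ?(ltnW uq) //.
  by case: (u) zu.
have := sumE p pq; rewrite !pE => [/eqP|t ts|t tr].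
- by rewrite -!(mulr_natl p.[z]) (inj_eq (mulIf pz)) eqr_nat.
- by rewrite mem_undup mem_cat ts orbT.
- by rewrite mem_undup mem_cat tr.
Qed.

End Spectrum.

Lemma graph_iso_sym (V W : finType) (e : rel V) (f : rel W) :
  graph_iso e f -> graph_iso f e.
Proof.
case=> phi [psi phiK psiK] ef; exists psi; first by exists phi.
by move=> x y; rewrite -ef !psiK.
Qed.

Lemma graph_iso_trans (U V W : finType) (d : rel U) (e : rel V) (f : rel W) :
  graph_iso d e -> graph_iso e f -> graph_iso d f.
Proof.
case=> phi bphi de [psi bpsi ef]; exists (psi \o phi); first exact: bij_comp.
by move=> x y; rewrite /= ef de.
Qed.

Lemma walks_bij (V W : finType) (e : rel V) (f : rel W) (phi : V -> W) k x y :
  bijective phi -> (forall a b, f (phi a) (phi b) = e a b) ->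
  walks f k (phi x) (phi y) = walks e k x y.
Proof.
move=> bphi ef; elim: k x => [|k IH] x /=; first by rewrite (bij_eq bphi).
rewrite (reindex phi) /=; last exact: onW_bij.
by apply: eq_bigr => z _; rewrite ef IH.
Qed.

Arguments walks : simpl never.

(** * Translation invariance of Cayley graphs *)

Section CayleyWalks.

Variables (gT : finGroupType) (S : {set gT}).
Local Open Scope group_scope.

Lemma CayE a b : Cay S a b = (a * b^-1 \in S).
Proof. by []. Qed.

Lemma Cay_sym : connection_set S -> symmetric (Cay S).
Proof.
by case=> _ SV a b; rewrite !CayE -{1}SV inE invMg invgK.
Qed.

Lemma walks_CayM k (g a b : gT) :
  walks (Cay S) k (a * g) (b * g) = walks (Cay S) k a b.
Proof.
apply: (walks_bij (phi := mulg^~ g)).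
  by exists (mulg^~ g^-1) => x; rewrite ?mulgK ?mulgKV.
by move=> x y; rewrite !CayE invMg !mulgA mulgK.
Qed.

Lemma walks_Cay1 k (a b : gT) : walks (Cay S) k a b = walks (Cay S) k (a * b^-1) 1%g.
Proof. by rewrite -(walks_CayM k b^-1 a b) mulgV. Qed.

Lemma sum_walks_Cay k :
  (\sum_x walks (Cay S) k x x = #|gT| * walks (Cay S) k 1%g 1%g)%N.
Proof.
under eq_bigr do rewrite walks_Cay1 mulgV.
by rewrite sum_nat_const.
Qed.

End CayleyWalks.

Lemma group_card_gt0 (gT : finGroupType) : 0 < #|gT|.
Proof. by rewrite -cardsT cardG_gt0. Qed.

Lemma cospectral_walks_Cay (gT hT : finGroupType) (S : {set gT})
    (S' : {set hT}) k : cospectral (Cay S) (Cay S') ->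
  walks (Cay S) k 1%g 1%g = walks (Cay S') k 1%g 1%g.
Proof.
move=> SS'; have := cospectral_walks k (group_card_gt0 gT) SS'.
rewrite !sum_walks_Cay -(cospectral_card SS') => /eqP.
by rewrite eqn_pmul2l ?group_card_gt0 // => /eqP.
Qed.

(** * Groups of order 27 in coordinates *)

Definition elts := iota 0 27.

Definition C27_op a b := (a + b) %% 27.

(* The code [i + 3 j + 9 k] stands for [x^i y^j z^k], where z is central,     *)
(* [y^3 = z^3 = 1], [x^3 = z^d] and [y x = x y z^c].                          *)
Definition nc_op (c d : bool) a b :=
  let i := a %% 3 + b %% 3 in
  i %% 3 + 3 * ((a %/ 3 + b %/ 3) %% 3)
  + 9 * ((a %/ 9 + b %/ 9 + c * (a %/ 3 %% 3 * (b %% 3)) + d * (i %/ 3)) %% 3).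

(** Only the values of [phi] below 27 matter; surjectivity and the cardinality give injectivity
    there ([coded_inj]). *)
Record coded (gT : finGroupType) (op : nat -> nat -> nat) (phi : nat -> gT) :=
  Coded {
    coded_card : #|gT| = 27;
    coded_surj : forall g, exists2 n, n < 27 & phi n = g;
    codedM : forall a b, a < 27 -> b < 27 -> (phi a * phi b)%g = phi (op a b)
  }.

Section Tables.

Variable op : nat -> nat -> nat.

Definition op_inv a := find (fun b => op a b == 0) elts.
(** In a group of odd order no nontrivial element is its own inverse, so order 27 yields 13
    representatives, and a connection set is a vector of 13 bits. *)
Definition reps := [seq a <- elts | a < op_inv a].
(* The index of the pair {a, a^-1}; the identity gets the junk index 13. *)
Definition pair_index a := minn (index a reps) (index (op_inv a) reps).
Definition diff_table : seq (seq nat) :=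
  let indices := map pair_index elts in let inverses := map op_inv elts in
  [seq [seq nth 13 indices (op a b) | b <- inverses] | a <- elts].

Definition valid_op :=
  [&& size reps == 13, op 0 0 == 0,
      all (fun a => [&& op_inv a < 27, op a (op_inv a) == 0,
             pair_index (op_inv a) == pair_index a,
             (pair_index a < 13) == (a != 0) &
             (a == 0) || (nth 0 reps (pair_index a) == a)
                      || (nth 0 reps (pair_index a) == op_inv a)]) elts,
      all (fun a => all (fun b => op a b < 27) elts) elts,
      perm_eq elts (0 :: reps ++ map op_inv reps) &
      all (fun i => pair_index (nth 0 reps i) == i) (iota 0 13)].

End Tables.

Lemma valid_C27 : valid_op C27_op.
Proof. by vm_compute. Qed.

Lemma valid_nc c d : valid_op (nc_op c d).
Proof. by case: c; case: d; vm_compute. Qed.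

Definition adj (D : seq (seq nat)) (b : seq bool) a c :=
  nth false b (nth 13 (nth [::] D a) c).

Definition pair_table op (D : seq (seq nat)) :=
  [seq [seq (nth 13 (nth [::] D r) z, nth 13 (nth [::] D z) 0) | z <- elts]
     | r <- reps op].

Definition walks2_table (T : seq (seq (nat * nat))) (b : seq bool) :=
  [seq count (fun p => nth false b p.1 && nth false b p.2) P | P <- T].

Definition sumsq (s : seq nat) : N :=
  foldr (fun c acc => N.add (N.mul (N.of_nat c) (N.of_nat c)) acc) N0 s.

(* Determines the numbers of closed walks of length 2, 3 and 4. *)
Definition key T b : nat * nat * N :=
  let c := walks2_table T b in (count id b, sumn (mask b c), sumsq c).

Lemma sumsqE s : N.to_nat (sumsq s) = \sum_(c <- s) c ^ 2.
Proof.
elim: s => [|c s IH]; first by rewrite big_nil.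
by rewrite big_cons /= N2Nat.inj_add N2Nat.inj_mul Nat2N.id IH plusE multE mulnn.
Qed.

Lemma sumn_mask_map (T : Type) (p : T -> bool) (f : T -> nat) s :
  sumn (mask (map p s) (map f s)) = \sum_(x <- s) p x * f x.
Proof.
elim: s => [|x s IH]; first by rewrite big_nil.
by rewrite big_cons /= -IH; case: (p x); rewrite ?mul1n ?mul0n.
Qed.

Section Coded.

Variables (gT : finGroupType) (op : nat -> nat -> nat) (phi : nat -> gT).
Hypotheses (cod : coded op phi) (val : valid_op op).

Let reps_lt r : r \in reps op -> r < 27.
Proof. by rewrite mem_filter mem_iota => /andP[_]. Qed.

Local Opaque op_inv reps pair_index.

Let size_reps : size (reps op) = 13.
Proof. by case/and5P: val => /eqP. Qed.

Let valP a : a < 27 ->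
  [/\ op_inv op a < 27, op a (op_inv op a) = 0,
      pair_index op (op_inv op a) = pair_index op a,
      (pair_index op a < 13) = (a != 0) &
      [\/ a = 0, nth 0 (reps op) (pair_index op a) = a
       | nth 0 (reps op) (pair_index op a) = op_inv op a]].
Proof.
move=> a27; have ae : a \in elts by rewrite mem_iota.
case/and5P: val => _ _ /allP/(_ a ae)/and5P[h1 /eqP h2 /eqP h3 /eqP h4 h5] _ _.
split; [exact: h1 | exact: h2 | exact: h3 | exact: h4 |].
by case/orP: h5 => [/orP[]|] /eqP h; [constructor 1 | constructor 2 | constructor 3].
Qed.

Lemma op_lt a b : a < 27 -> b < 27 -> op a b < 27.
Proof.
move=> a27 b27; case/and5P: val => _ _ _ + _.
by move=> /allP/(_ a)/[!mem_iota]/(_ a27)/allP/(_ b)/[!mem_iota]/(_ b27).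
Qed.

Let perm_elts : perm_eq elts (0 :: reps op ++ map (op_inv op) (reps op)).
Proof. by case/and5P: val => _ _ _ _ /andP[]. Qed.

Let pair_index_reps i : i < 13 -> pair_index op (nth 0 (reps op) i) = i.
Proof.
move=> i13; case/and5P: val => _ _ _ _ /andP[_ /allP/(_ i)].
by rewrite mem_iota => /(_ i13)/eqP.
Qed.

Lemma coded1 : phi 0 = 1%g.
Proof.
have := codedM cod (isT : 0 < 27) (isT : 0 < 27).
case/and5P: val => _ /eqP-> _ _ _ /(congr1 (mulg (phi 0)^-1)%g).
by rewrite mulKg mulVg.
Qed.

Lemma codedV a : a < 27 -> phi (op_inv op a) = (phi a)^-1%g.
Proof.
move=> a27; have [a27' aV _ _ _] := valP a27.
apply/esym/eqP; rewrite eq_invg_mul; apply/eqP.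
by rewrite (codedM cod) // aV coded1.
Qed.

Lemma coded_perm : perm_eq (index_enum gT) (map phi elts).
Proof.
have sub : {subset enum gT <= map phi elts}.
  move=> g _; have [n n27 <-] := coded_surj cod g.
  by rewrite map_f // mem_iota.
have [|eqs eqm] := uniq_min_size (enum_uniq gT) sub.
  by rewrite size_map -cardE (coded_card cod).
rewrite uniq_perm ?index_enum_uniq //.
  by rewrite -(eq_uniq eqs eqm) enum_uniq.
by move=> g; rewrite -eqm mem_enum mem_index_enum.
Qed.

Lemma coded_inj : {in gtn 27 &, injective phi}.
Proof.
move=> a b; rewrite !inE => a27 b27 ab.
have u : uniq (map phi elts) by rewrite -(perm_uniq coded_perm) index_enum_uniq.
have := nth_uniq 1%g _ _ u; rewrite size_map size_iota => /(_ a b a27 b27).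
by rewrite !(nth_map 0) ?size_iota // !nth_iota // ab eqxx => /esym/eqP.
Qed.

Definition code g := index g (map phi elts).

Lemma code_lt g : code g < 27.
Proof.
have [n n27 <-] := coded_surj cod g.
by rewrite -[27]/(size (map phi elts)) index_mem map_f // mem_iota.
Qed.

Lemma codeK g : phi (code g) = g.
Proof.
have := code_lt g; rewrite -[27]/(size (map phi elts)) index_mem.
move=> gin; have := nth_index 1%g gin.
by rewrite (nth_map 0) ?nth_iota ?code_lt // size_iota code_lt.
Qed.

Lemma phiK a : a < 27 -> code (phi a) = a.
Proof. by move=> a27; apply: coded_inj; rewrite ?inE ?code_lt ?codeK. Qed.

Lemma sum_coded (F : gT -> nat) :
  (\sum_g F g = \sum_(a <- elts) F (phi a))%N.
Proof. by rewrite (perm_big _ coded_perm) big_map. Qed.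

Lemma sum_reps (F : gT -> nat) : (forall g, F g^-1%g = F g) ->
  \sum_g F g = F 1%g + 2 * \sum_(r <- reps op) F (phi r).
Proof.
move=> FV; rewrite sum_coded (perm_big _ perm_elts) big_cons big_cat big_map /=.
rewrite coded1 mul2n -addnn; congr (_ + (_ + _)).
rewrite !big_seq; apply: eq_bigr => r /reps_lt r27.
by rewrite codedV.
Qed.

Definition bits (S : {set gT}) := [seq phi r \in S | r <- reps op].

Definition bset (b : seq bool) : {set gT} :=
  [set g | nth false b (pair_index op (code g))].

Lemma size_bits S : size (bits S) = 13.
Proof. by rewrite size_map. Qed.

Lemma mem_bits S a : connection_set S -> a < 27 ->
  (phi a \in S) = nth false (bits S) (pair_index op a).
Proof.
case=> S1 SV a27; have [_ _ _ i13 ra] := valP a27.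
case: eqP ra => [a0 _|an0 /= ra] in i13 *.
  by rewrite nth_default ?size_bits 1?leqNgt ?i13 // a0 coded1 (negPf S1).
rewrite (nth_map 0) ?size_reps ?i13 //; case: ra => [a0|->|->] //.
by rewrite codedV // -mem_invg SV.
Qed.

Lemma bset_connection b : size b = 13 -> connection_set (bset b).
Proof.
move=> b13; split.
  rewrite inE -coded1 phiK // nth_default //.
  by have [_ _ _ i13 _] := valP (isT : 0 < 27); rewrite b13 leqNgt i13.
apply/setP => g; rewrite !inE; have [a a27 <-] := coded_surj cod g.
have [a27' _ aV _ _] := valP a27.
by rewrite -(codedV a27) (phiK a27) (phiK a27') aV.
Qed.

Lemma bsetK b : size b = 13 -> bits (bset b) = b.
Proof.
move=> b13; apply: (@eq_from_nth _ false) => [|i]; rewrite size_bits // => i13.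
rewrite (nth_map 0) ?size_reps // inE phiK ?pair_index_reps //.
by rewrite reps_lt ?mem_nth ?size_reps.
Qed.

Lemma Cay_adj S a c : connection_set S -> a < 27 -> c < 27 ->
  Cay S (phi a) (phi c) = adj (diff_table op) (bits S) a c.
Proof.
move=> conS a27 c27; have [c27' _ _ _ _] := valP c27.
rewrite CayE -codedV // (codedM cod) // mem_bits ?op_lt //.
rewrite /adj /diff_table (nth_map 0 [::] _ (a27 : a < size elts)).
rewrite -map_comp (nth_map 0 13 _ (c27 : c < size elts)).
rewrite (nth_iota 0 0 a27) (nth_iota 0 0 c27) /=.
have ac27 := op_lt a27 c27'.
by rewrite (nth_map 0 13 _ (ac27 : _ < size elts)) (nth_iota 0 0 ac27).
Qed.

Lemma walks2_coded S r : connection_set S -> r < 27 ->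
  walks (Cay S) 2 (phi r) 1%g
  = count (fun p => nth false (bits S) p.1 && nth false (bits S) p.2)
      [seq (nth 13 (nth [::] (diff_table op) r) z,
            nth 13 (nth [::] (diff_table op) z) 0) | z <- elts].
Proof.
move=> conS r27; rewrite -[2]/(1 + 1) walksD sum_coded count_map -sum1_count.
rewrite [RHS]big_mkcond /= !big_seq; apply: eq_bigr => z; rewrite mem_iota => z27.
rewrite !walks1 -coded1 !Cay_adj // /adj.
by case: (nth false _ _); case: (nth false _ _).
Qed.

(** A closed walk of length 3 is an edge followed by a walk of length 2 back; one of length 4 splits
    at its midpoint, giving a sum of squares in which the identity contributes |S|^2. Inverse
    elements contribute equally, whence the factors 2. *)
Lemma key_walks T S : T = pair_table op (diff_table op) -> connection_set S ->
  [/\ walks (Cay S) 2 1%g 1%g = 2 * (key T (bits S)).1.1,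
      walks (Cay S) 3 1%g 1%g = 2 * (key T (bits S)).1.2 &
      walks (Cay S) 4 1%g 1%g
      = (2 * (key T (bits S)).1.1) ^ 2 + 2 * N.to_nat (key T (bits S)).2].
Proof.
move=> defT conS; have symS := Cay_sym conS.
have w1 z : walks (Cay S) 1 1%g z = (z \in S).
  by rewrite walks1 symS CayE invg1 mulg1.
have w1V z : walks (Cay S) 1 z 1%g = (z \in S) by rewrite walks_sym ?w1.
have S0 : (1%g \in S) = false by case: conS => /negPf.
have SV z : (z^-1%g \in S) = (z \in S) by case: conS => _ {2}<-; rewrite inE.
have w2 : walks (Cay S) 2 1%g 1%g = 2 * count id (bits S).
  rewrite -[2 in LHS]/(1 + 1) walksD sum_reps; last first.
    by move=> g; rewrite !w1 !w1V !SV.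
  rewrite w1 S0 add0n; congr (2 * _); rewrite count_map -sum1_count [RHS]big_mkcond.
  by apply: eq_bigr => r _; rewrite w1 w1V /=; case: (_ \in S).
have w2V z : walks (Cay S) 2 z^-1%g 1%g = walks (Cay S) 2 z 1%g.
  by rewrite [RHS]walks_sym // [RHS]walks_Cay1 mul1g.
have T2 : walks2_table T (bits S)
    = [seq walks (Cay S) 2 (phi r) 1%g | r <- reps op].
  rewrite defT /walks2_table -map_comp; apply/eq_in_map => r /reps_lt r27.
  by rewrite [RHS]walks2_coded.
split=> //.
- rewrite -[3]/(1 + 2) walksD sum_reps; last by move=> g; rewrite !w1 w2V SV.
  rewrite w1 S0 mul0n add0n; congr (2 * _).
  rewrite /key T2 sumn_mask_map; apply: eq_bigr => r _.
  by rewrite w1.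
- have w2' z : walks (Cay S) 2 1%g z = walks (Cay S) 2 z 1%g by rewrite walks_sym.
  rewrite -[4]/(2 + 2) walksD sum_reps; last by move=> g; rewrite !w2' !w2V.
  rewrite w2 mulnn; congr (_ + 2 * _).
  rewrite /key T2 sumsqE big_map; apply: eq_bigr => r _.
  by rewrite w2'.
Qed.

End Coded.

(* Unlike [all] and [has], these stop early also under call by value. *)
Definition allc (T : Type) (p : pred T) :=
  fix allc s := if s is x :: s' then if p x then allc s' else false else true.

Definition hasc (T : Type) (p : pred T) :=
  fix hasc s := if s is x :: s' then if p x then true else hasc s' else false.

Lemma allcE (T : Type) (p : pred T) : allc p =1 all p.
Proof. by elim=> //= x s ->. Qed.

Lemma hascE (T : Type) (p : pred T) : hasc p =1 has p.
Proof. by elim=> //= x s ->. Qed.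

Definition frame_iso (D D' : seq (seq nat)) (b b' : seq bool) (f : seq nat) :=
  allc (fun a => allc (fun c =>
    adj D b a c == adj D' b' (nth 0 f a) (nth 0 f c)) elts) elts.

Definition is_frame (f : seq nat) :=
  [&& size f == 27, uniq f & all (gtn 27) f].

Lemma frame_iso_Cay (gT hT : finGroupType) op op' phi phi'
    (S : {set gT}) (S' : {set hT}) f :
    coded op phi -> valid_op op -> coded op' phi' -> valid_op op' ->
    connection_set S -> connection_set S' -> is_frame f ->
    frame_iso (diff_table op) (diff_table op')
      (bits op phi S) (bits op' phi' S') f ->
  graph_iso (Cay S) (Cay S').
Proof.
move=> cod val cod' val' conS conS' /and3P[/eqP sf uf /allP f27].
rewrite /frame_iso allcE => /allP isof.
have nf a : a < 27 -> nth 0 f a < 27 by move=> a27; apply/f27/mem_nth; rewrite sf.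
pose psi g := phi' (nth 0 f (code phi g)).
have psiE a : a < 27 -> psi (phi a) = phi' (nth 0 f a).
  by move=> a27; rewrite /psi (phiK cod).
exists psi.
  apply: inj_card_bij; last by rewrite (coded_card cod) (coded_card cod').
  move=> g h; have [a a27 <-] := coded_surj cod g.
  have [c c27 <-] := coded_surj cod h; rewrite !psiE //.
  move/(coded_inj cod'); rewrite !inE !nf // => /(_ isT isT)/eqP.
  by rewrite nth_uniq ?sf // => /eqP->.
move=> g h; have [a a27 <-] := coded_surj cod g.
have [c c27 <-] := coded_surj cod h.
rewrite !psiE // (Cay_adj cod') ?nf // (Cay_adj cod) //.
have ae : a \in elts by rewrite mem_iota.
have ce : c \in elts by rewrite mem_iota.
move: (isof a ae); rewrite allcE => /allP/(_ c ce)/eqP/esym//.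
Qed.

Lemma closed_walks_inj w2 w3 w4 (k k' : nat * nat * N) :
  [/\ w2 = 2 * k.1.1, w3 = 2 * k.1.2 & w4 = (2 * k.1.1) ^ 2 + 2 * N.to_nat k.2] ->
  [/\ w2 = 2 * k'.1.1, w3 = 2 * k'.1.2
    & w4 = (2 * k'.1.1) ^ 2 + 2 * N.to_nat k'.2] ->
  k = k'.
Proof.
case: k k' => [[a1 a2] a3] [[b1 b2] b3] [-> -> ->] /= [/eqP].
rewrite eqn_pmul2l // => /eqP <- /eqP; rewrite eqn_pmul2l // => /eqP <- /eqP.
by rewrite eqn_add2l eqn_pmul2l // => /eqP /N2Nat.inj->.
Qed.

Lemma walks_key (gT hT : finGroupType) op op' phi phi'
    (S : {set gT}) (S' : {set hT}) :
    coded op phi -> valid_op op -> coded op' phi' -> valid_op op' ->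
    connection_set S -> connection_set S' ->
    (forall k, walks (Cay S) k 1%g 1%g = walks (Cay S') k 1%g 1%g) ->
  key (pair_table op (diff_table op)) (bits op phi S)
  = key (pair_table op' (diff_table op')) (bits op' phi' S').
Proof.
move=> cod val cod' val' conS conS' SS'.
apply: (closed_walks_inj (key_walks cod val (erefl _) conS)).
rewrite !SS'; exact: (key_walks cod' val' (erefl _) conS').
Qed.

(** * Fibred sets and exhaustive searches over connection sets *)

Fixpoint allbits n (f : seq bool -> bool) :=
  if n is n'.+1 then
    if allbits n' (fun b => f (true :: b)) then allbits n' (fun b => f (false :: b))
    else false
  else f [::].

Lemma allbitsP n f b : allbits n f -> size b = n -> f b.
Proof.
elim: n f b => [|n IH] f [|x b] //= /andP[ft ff] [sb].
case: x; first exact: (IH (fun b => f (true :: b))).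
exact: (IH (fun b => f (false :: b))).
Qed.

Definition C27_diff := Eval vm_compute in diff_table C27_op.
Definition C27_pairs := Eval vm_compute in pair_table C27_op C27_diff.

Lemma C27_diffE : diff_table C27_op = C27_diff.
Proof. by vm_compute. Qed.

Lemma C27_pairsE : pair_table C27_op C27_diff = C27_pairs.
Proof. by vm_compute. Qed.

Definition nc_diff00 := Eval vm_compute in diff_table (nc_op false false).
Definition nc_diff01 := Eval vm_compute in diff_table (nc_op false true).
Definition nc_diff10 := Eval vm_compute in diff_table (nc_op true false).
Definition nc_diff11 := Eval vm_compute in diff_table (nc_op true true).

Definition nc_diff (c d : bool) :=
  if c then if d then nc_diff11 else nc_diff10
  else if d then nc_diff01 else nc_diff00.

Definition nc_pairs00 := Eval vm_compute in pair_table (nc_op false false) nc_diff00.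
Definition nc_pairs01 := Eval vm_compute in pair_table (nc_op false true) nc_diff01.
Definition nc_pairs10 := Eval vm_compute in pair_table (nc_op true false) nc_diff10.
Definition nc_pairs11 := Eval vm_compute in pair_table (nc_op true true) nc_diff11.

Definition nc_pairs (c d : bool) :=
  if c then if d then nc_pairs11 else nc_pairs10
  else if d then nc_pairs01 else nc_pairs00.

Lemma nc_diffE c d : diff_table (nc_op c d) = nc_diff c d.
Proof. by case: c; case: d; vm_compute. Qed.

Lemma nc_pairsE c d : pair_table (nc_op c d) (nc_diff c d) = nc_pairs c d.
Proof. by case: c; case: d; vm_compute. Qed.

(* Representatives, up to graph isomorphism, of the connection sets of C27    *)
(* that are unions of <9>-cosets outside <3>: [s] pairs of such cosets, [t]   *)
(* pairs of elements of order 9 and, if [e], the elements of order 3.  The    *)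
(* i-th bit stands for the pair {i + 1, -(i + 1)}.                            *)
Definition gamma t s (e : bool) : seq bool :=
  [seq [|| a \in take t [:: 3; 6; 12],
           a \in take (3 * s) [:: 1; 8; 10; 2; 7; 11; 4; 5; 13] | e && (a == 9)]
     | a <- iota 1 13].

Definition gammas :=
  [seq gamma ts.1 ts.2 e | ts <- allpairs pair (iota 0 4) (iota 0 4),
                           e <- [:: false; true]].

Definition keyed_gammas :=
  Eval vm_compute in [seq (b, key C27_pairs b) | b <- gammas].

(* The nontrivial cosets of <9> up to sign; the last one lies in <3>. *)
Definition coset_pairs :=
  [:: [:: 0; 7; 9]; [:: 1; 6; 10]; [:: 3; 4; 12]; [:: 2; 5; 11]].

Definition full_or_empty (b : seq bool) (s : seq nat) :=
  all (fun i => nth false b i == nth false b (head 0 s)) s.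

Definition fibred b := all (full_or_empty b) (take 3 coset_pairs).

(* The bijection [i + 3 j + 9 k |-> w^k v^j u^i]. *)
Definition frame (op : nat -> nat -> nat) u v w : seq nat :=
  [seq iter (n %% 3) (op^~ u) (iter (n %/ 3 %% 3) (op^~ v) (iter (n %/ 9) (op^~ w) 0))
     | n <- elts].

(** Candidate isomorphisms from graphs on C27. When v^3 is nontrivial, w = v^3 sends 3 j + 9 k to
    v^(j + 3 k); otherwise [w] ranges over all representatives. *)
Definition frames op us :=
  let vws := [seq (v, w) | v <- reps op,
                           w <- let v3 := op v (op v v) in
                                if v3 == 0 then reps op else [:: v3]] in
  [seq f <- [seq frame op u vw.1 vw.2 | vw <- vws, u <- us] | is_frame f].

Definition key_test (T : seq (seq (nat * nat))) b (k : nat * nat * N) :=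
  if count id b == k.1.1 then
    let c := walks2_table T b in
    if sumn (mask b c) == k.1.2 then N.eqb (sumsq c) k.2 else false
  else false.

(** Whenever a set satisfying [P] has the key of some [gamma], an explicit isomorphism must be found
    in [fs]. The list [fs] only has to be large enough for this; it need not contain all
    isomorphisms. *)
Definition rigid_test (P : seq bool -> bool) D T fs :=
  allbits 13 (fun b => if P b then allc (fun bk =>
    if key_test T b bk.2 then hasc (frame_iso C27_diff D bk.1 b) fs else true)
    keyed_gammas else true).

Lemma key_testP T b k : reflect (key T b = k) (key_test T b k).
Proof.
case: k => [[k1 k2] k3]; rewrite /key /key_test /=.
case: eqP => [->|n1]; last by constructor=> -[].
case: eqP => [->|n2]; last by constructor=> -[].
case E: N.eqb; constructor; first by move/N.eqb_eq: E => ->.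
by move=> [n3]; rewrite n3 N.eqb_refl in E.
Qed.

Lemma mem_keyed_gammas b : b \in gammas -> (b, key C27_pairs b) \in keyed_gammas.
Proof.
have <- : [seq (b, key C27_pairs b) | b <- gammas] = keyed_gammas.
  by vm_compute.
exact: (map_f (fun b => (b, key C27_pairs b))).
Qed.

Definition nc_frames00 :=
  Eval vm_compute in frames (nc_op false false) [:: 1; 3; 9].
Definition nc_frames01 :=
  Eval vm_compute in frames (nc_op false true) [:: 1; 3; 9; 10; 19].
Definition nc_frames10 :=
  Eval vm_compute in frames (nc_op true false) [:: 1; 3; 9].
Definition nc_frames11 :=
  Eval vm_compute in frames (nc_op true true) [:: 1; 3; 9].
Definition C27_frames :=
  Eval vm_compute in frames C27_op [:: 1; 2; 4; 23; 25; 26].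

Definition nc_frames (c d : bool) :=
  if c then if d then nc_frames11 else nc_frames10
  else if d then nc_frames01 else nc_frames00.

Lemma nc_rigid c d : rigid_test xpredT (nc_diff c d) (nc_pairs c d) (nc_frames c d).
Proof. by case: c; case: d; vm_compute. Qed.

Lemma C27_rigid : rigid_test fibred C27_diff C27_pairs C27_frames.
Proof. by vm_compute. Qed.

Lemma rigid_testP P D T fs b0 b : rigid_test P D T fs -> all is_frame fs ->
  size b = 13 -> P b -> b0 \in gammas -> key C27_pairs b0 = key T b ->
  exists2 f, is_frame f & frame_iso C27_diff D b0 b f.
Proof.
move=> rt /allP frs b13 Pb b0g eqk; have := allbitsP rt b13.
rewrite Pb allcE => /allP/(_ _ (mem_keyed_gammas b0g)) /=.
have -> : key_test T b (key C27_pairs b0) by apply/key_testP.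
by rewrite hascE => /hasP[f /frs]; exists f.
Qed.

Lemma nc_rigid_iso c d b0 b : size b = 13 -> b0 \in gammas ->
  key C27_pairs b0 = key (nc_pairs c d) b ->
  exists2 f, is_frame f & frame_iso C27_diff (nc_diff c d) b0 b f.
Proof.
move=> b13 b0g eqk; apply: (rigid_testP (nc_rigid c d)) eqk => //.
by case: c; case: d; vm_compute.
Qed.

Lemma C27_rigid_iso b0 b : size b = 13 -> fibred b -> b0 \in gammas ->
  key C27_pairs b0 = key C27_pairs b ->
  exists2 f, is_frame f & frame_iso C27_diff C27_diff b0 b f.
Proof.
move=> b13 fb b0g eqk; by apply: (rigid_testP C27_rigid) eqk.
Qed.

Lemma size_gamma b : b \in gammas -> size b = 13.
Proof.
have : all (fun b => size b == 13) gammas by vm_compute.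
by move=> /allP h /h/eqP.
Qed.

(** There are 2^7 fibred sets: three bits for the coset pairs outside <3>, four for the pairs
    inside. Together with [C27_rigid] this reduces them to the 32 sets [gamma]. *)
Lemma fibred_key b : size b = 13 -> fibred b ->
  exists2 b0, b0 \in gammas & key C27_pairs b0 = key C27_pairs b.
Proof.
have: allbits 13 (fun b => if fibred b then
    hasc (fun b0 => key_test C27_pairs b (key C27_pairs b0)) gammas else true).
  by vm_compute.
move=> /allbitsP h b13 fb; have := h _ b13; rewrite fb hascE.
by case/hasP => b0 b0g /key_testP->; exists b0.
Qed.

(* Two sets with the same eigenvalue at a primitive character can only differ *)
(* on cosets of <9> that are full in one of them and empty in the other.      *)
Definition flip_cosets (b m : seq bool) : seq bool :=
  let ms := [seq x.1 && full_or_empty b x.2 | x <- zip m coset_pairs] in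
  [seq nth false b i (+) has (fun x => x.1 && (i \in x.2)) (zip ms coset_pairs)
     | i <- iota 0 13].

Definition flip_test :=
  allbits 13 (fun b => if fibred b then true else allbits 4 (fun m =>
    let b' := flip_cosets b m in
    if b' == b then true else
    if count id b' == count id b then ~~ key_test C27_pairs b' (key C27_pairs b)
    else true)).

Lemma flip_testT : flip_test.
Proof. by vm_compute. Qed.

Lemma key_count T b : (key T b).1.1 = count id b.
Proof. by []. Qed.

(** By search over all sets and all flips: a flip that changes a non-fibred set also changes its
    degree or its number of closed walks of length 3 or 4. *)
Lemma flip_cosets_id b m : size b = 13 -> size m = 4 -> ~~ fibred b ->
  key C27_pairs (flip_cosets b m) = key C27_pairs b -> flip_cosets b m = b.
Proof.
move=> b13 m4 /negPf nfb eqk; have := allbitsP flip_testT b13; rewrite nfb.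
move=> h; move: (allbitsP h m4); cbv beta zeta.
case: (flip_cosets b m =P b) => // _.
rewrite -!(key_count C27_pairs) eqk eqxx => /key_testP nk.
by case: (nk eqk).
Qed.

(** * Eigenvalues *)

Section Eigenvalues.

Local Open Scope ring_scope.

Lemma spectrumP (V : finType) (e : rel V) z :
  reflect (exists2 v : V -> algC, exists x, v x != 0
             & forall y, \sum_x (e x y)%:R * v x = z * v y)
          (z \in spectrum (adjacency_mx e)).
Proof.
rewrite -root_prod_XsubC -spectrumE -eigenvalue_root_char.
apply: (iffP eigenvalueP) => [[v vA v0]|[v [x vx] vA]].
  exists (fun x => v 0 (enum_rank x)).
    by have [i vi] := rV0Pn _ v0; exists (enum_val i); rewrite enum_valK.
  move=> y; move/rowP/(_ (enum_rank y)): vA; rewrite !mxE => <-.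
  rewrite (reindex (fun i : 'I_#|V| => enum_val i)) /=; last exact/onW_bij/enum_val_bij.
  by apply: eq_bigr => i _; rewrite mxE enum_valK enum_rankK mulrC.
exists (\row_i v (enum_val i)).
  apply/rowP => j; rewrite !mxE -vA.
  rewrite (reindex (fun i : 'I_#|V| => enum_val i)) /=; last exact/onW_bij/enum_val_bij.
  by apply: eq_bigr => i _; rewrite !mxE mulrC.
by apply/rV0Pn; exists (enum_rank x); rewrite mxE enum_rankK.
Qed.

Lemma sum_expr_prim_root n (w : algC) i : (i < n)%N ->
  n.-primitive_root w -> \sum_(j < n) w ^+ (j * i) = if i == 0%N then n%:R else 0.
Proof.
move=> i_n prw; case: eqP => [->|/eqP i0].
  by under eq_bigr do rewrite muln0 expr0; rewrite sumr_const card_ord.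
have wi : w ^+ i - 1 != 0.
  by rewrite subr_eq0 -(prim_order_dvd prw) gtnNdvd // lt0n.
apply/(mulfI wi); rewrite mulr0; under eq_bigr do rewrite mulnC exprM.
by rewrite -subrX1 -exprM mulnC exprM (prim_expr_order prw) expr1n subrr.
Qed.

(** * Projections onto the eigenspaces of a right translation *)

Section Twist.

Variables (gT : finGroupType) (g : gT) (n : nat).
Hypothesis gn : (g ^+ n.+1 = 1)%g.

Definition twist (c : algC) (v : gT -> algC) h :=
  \sum_(i < n.+1) c ^+ i * v (h * g ^+ i)%g.

Lemma twistM c v h : c ^+ n.+1 = 1 -> c * twist c v (h * g)%g = twist c v h.
Proof.
move=> cn; rewrite /twist big_ord_recr big_ord_recl /= mulrDr addrC mulrA -exprS cn.
rewrite -mulgA -expgS gn mulg1 expr0 mul1r; congr (_ + _).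
rewrite mulr_sumr; apply: eq_bigr => i _.
by rewrite mulrA -exprS -mulgA -expgS.
Qed.

(** Summing the twists over all powers of [w] gives (n + 1) v, so they cannot all vanish. *)
Lemma twist_neq0 w v : n.+1.-primitive_root w -> (exists x, v x != 0) ->
  exists j, exists x, twist (w ^+ j) v x != 0.
Proof.
move=> prw [x vx].
have: \sum_(j < n.+1) twist (w ^+ j) v x != 0.
  rewrite exchange_big /=.
  under eq_bigr => i _.
    under eq_bigr => j _ do rewrite -exprM.
    rewrite -mulr_suml sum_expr_prim_root //.
  over.
  rewrite big_ord_recl /= mulg1 big1 ?addr0 => [|i _]; last by rewrite mul0r.
  by rewrite mulf_neq0 // (prim_root_natf_neq0 prw).
by move/eqP => nz; have /existsP[j tj] : [exists j : 'I_n.+1, twist (w ^+ j) v x != 0];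
  [apply: contraT; rewrite negb_exists => /forallP t0; case: nz; apply: big1 => j _;
   apply/eqP; move: (t0 j); rewrite negbK | exists j, x].
Qed.

(** Right translations commute with the adjacency operator. *)
Lemma twist_eigen (S : {set gT}) c v z :
  (forall y, \sum_x (Cay S x y)%:R * v x = z * v y) ->
  forall y, \sum_x (Cay S x y)%:R * twist c v x = z * twist c v y.
Proof.
move=> vS y; under eq_bigr do rewrite mulr_sumr.
rewrite exchange_big mulr_sumr; apply: eq_bigr => i _.
rewrite mulrCA -vS mulr_sumr.
rewrite [RHS](reindex (fun x => (x * g ^+ i)%g)) /=; last first.
  by exists (fun x => (x * (g ^+ i)^-1)%g) => x _; rewrite ?mulgK ?mulgKV.
apply: eq_bigr => x _; rewrite mulrCA !CayE invMg mulgA mulgK //.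
Qed.

Lemma twist_commute (h : gT) c d v : commute g h ->
  (forall y, d * v (y * h)%g = v y) ->
  forall y, d * twist c v (y * h)%g = twist c v y.
Proof.
move=> gh vh y; rewrite mulr_sumr; apply: eq_bigr => i _.
by rewrite mulrCA -mulgA (commuteX i (commute_sym gh)) mulgA vh.
Qed.

End Twist.

Lemma sum_Cay (gT : finGroupType) op phi (S : {set gT}) (F : gT -> algC) y :
  coded op phi ->
  \sum_x (Cay S x y)%:R * F x = \sum_(a <- elts) (phi a \in S)%:R * F (phi a * y)%g.
Proof.
move=> cod; rewrite (reindex (fun s => (s * y)%g)) /=; last first.
  by exists (fun x => (x * y^-1)%g) => x _; rewrite ?mulgK ?mulgKV.
rewrite (perm_big _ (coded_perm cod)) big_map; apply: eq_bigr => a _.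
by rewrite CayE mulgK.
Qed.

(** * Character sums and the spectrum on C27 *)

Section Cyclic.

Variable zeta : algC.
Hypothesis pr_zeta : 27.-primitive_root zeta.

Definition char_sum (e : nat -> bool) k : algC :=
  \sum_(a <- elts) (e a)%:R * zeta ^+ (k * a).

Lemma char_sum_mod e k : char_sum e (k %% 27) = char_sum e k.
Proof.
apply: eq_bigr => a _; congr (_ * _).
by rewrite -(prim_expr_mod pr_zeta) modnMml prim_expr_mod.
Qed.

Section CyclicSpectrum.

Variables (gT : finGroupType) (phi : nat -> gT).
Hypothesis cod : coded C27_op phi.

Lemma C27_spectrum (S : {set gT}) k :
  char_sum (fun a => phi a \in S) k \in spectrum (adjacency_mx (Cay S)).
Proof.
apply/spectrumP; exists (fun g => zeta ^+ (k * code phi g)).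
  by exists 1%g; rewrite expf_neq0 // (prim_root_eq0 pr_zeta).
move=> y; rewrite (sum_Cay _ _ _ cod) mulr_suml.
have [c c27 <-] := coded_surj cod y.
apply: eq_big_seq => a; rewrite mem_iota => a27.
rewrite (codedM cod a27 c27) (phiK cod c27).
rewrite (phiK cod (ltn_pmod (a + c) (isT : 0 < 27)%N)).
rewrite -mulrA -exprD -mulnDr.
by congr (_ * _); rewrite -(prim_expr_mod pr_zeta) modnMmr prim_expr_mod.
Qed.

(** Twisting an eigenvector by a generator yields a multiple of a character with the same
    eigenvalue. *)
Lemma C27_spectrumP (S : {set gT}) z :
  z \in spectrum (adjacency_mx (Cay S)) ->
  exists k, z = char_sum (fun a => phi a \in S) k.
Proof.
have phiS a : (a < 26)%N -> phi a.+1 = (phi a * phi 1)%g.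
  move=> a26; rewrite (codedM cod) ?(ltn_trans a26) //.
  by rewrite /C27_op addn1 modn_small.
have g27 : (phi 1 ^+ 27 = 1)%g.
  by rewrite -(coded_card cod) -cardsT expg_cardG ?inE.
case/spectrumP => v v0 vS.
have [j w0] := twist_neq0 (phi 1) pr_zeta v0.
have wS := twist_eigen (phi 1) 26 (zeta ^+ j) vS.
have wM h := twistM g27 (c := zeta ^+ j) v h.
move: (twist _ _ _ _) w0 wS wM => w [x wx] wS wM.
have c27 : zeta ^+ j ^+ 27 = 1 by rewrite exprAC (prim_expr_order pr_zeta) expr1n.
have wE a : (a < 27)%N -> w (phi a) = zeta ^+ (26 * j * a) * w (phi 0).
  elim: a => [|a IH] a27; first by rewrite muln0 mul1r.
  rewrite mulnS addnC exprD -mulrA mulrCA -IH ?(ltnW a27) // -(wM (phi a) c27).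
  rewrite -phiS // mulrA -exprD -mulSnr mulnC exprM.
  by rewrite c27 mul1r.
(* With c = zeta^j, the twist satisfies w(hg) = c^-1 w(h), and c^-1 = zeta^(26 j). *)
exists (26 * j)%N; have w1 : w (phi 0) != 0.
  apply: contraNneq wx => w0; have [a a27 <-] := coded_surj cod x.
  by rewrite wE // w0 mulr0.
apply: (mulIf w1); rewrite -wS (sum_Cay _ _ _ cod) mulr_suml.
apply: eq_big_seq => a; rewrite mem_iota => a27.
by rewrite (coded1 cod valid_C27) mulg1 -(coded1 cod valid_C27) wE ?mulrA.
Qed.

End CyclicSpectrum.

Lemma zeta_coset : 1 + zeta ^+ 9 + zeta ^+ 18 = 0.
Proof.
have n1 : zeta ^+ 9 - 1 != 0 by rewrite subr_eq0 -(prim_order_dvd pr_zeta).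
apply: (mulfI n1); rewrite mulr0 -[18%N]/(9 * 2)%N exprM.
have := subrX1 (zeta ^+ 9) 3; rewrite !big_ord_recl big_ord0 /= addr0 expr0 expr1 addrA.
by move=> <-; rewrite -exprM (prim_expr_order pr_zeta) subrr.
Qed.

(** The powers of zeta below 18 are independent over Q, since Phi_27 has degree 18. Eliminating the
    others by zeta^(18 + i) = - zeta^i - zeta^(9 + i) leaves the coefficients of [q], which must
    vanish. *)
Lemma zeta_free (c : nat -> int) :
  \sum_(a <- elts) (c a)%:~R * zeta ^+ a = 0 ->
  forall a, (a < 9)%N -> c a = c (18 + a)%N /\ c (9 + a)%N = c (18 + a)%N.
Proof.
move=> sum0; pose q : {poly rat} := \poly_(i < 18) (c i - c (18 + i %% 9)%N)%:~R.
have qz : root (map_poly ratr q) zeta.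
  rewrite /root -[X in _ == X]sum0; apply/eqP.
  have -> : (map_poly ratr q).[zeta]
      = \sum_(i <- iota 0 18) (c i - c (18 + i %% 9)%N)%:~R * zeta ^+ i.
    rewrite (_ : map_poly ratr q
        = \poly_(i < 18) (c i - c (18 + i %% 9)%N)%:~R); last first.
      apply/polyP => i; rewrite coef_map !coef_poly.
      by case: ifP => _; rewrite ?(raddf0, rmorph0) /= ?ratr_int ?rmorph0.
    rewrite horner_poly -(big_mkord xpredT
      (fun i => (c i - c (18 + i %% 9)%N)%:~R * zeta ^+ i)).
    by rewrite /index_iota subn0.
  have [l lE] : {l | l = iota 0 9} by exists (iota 0 9).
  have -> : elts = l ++ map (addn 9) l ++ map (addn 18) l by rewrite lE.
  have -> : iota 0 18 = l ++ map (addn 9) l by rewrite lE.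
  rewrite !big_cat !big_map /= -!big_split /=; apply: eq_big_seq => i.
  rewrite lE mem_iota => i9; rewrite modnDl (modn_small i9) !rmorphB /= !mulrBl.
  have -> : zeta ^+ (18 + i) = - zeta ^+ i - zeta ^+ (9 + i).
    have /eqP := zeta_coset; rewrite addrC addr_eq0 => /eqP z18.
    by rewrite !exprD z18 mulNr mulrDl mul1r opprD.
  by rewrite mulrDr !mulrN addrACA [RHS]addrA.
have q0 : q = 0.
  have [p [pE _] pP] := minCpolyP zeta.
  have := congr1 (fun r : {poly algC} => size r) pE.
  rewrite size_map_poly (minCpoly_cyclotomic pr_zeta) size_cyclotomic => sp.
  apply: contraTeq qz => q0; rewrite pP; apply/negP => /(dvdp_leq q0).
  by rewrite -sp leqNgt ltnS (leq_trans (size_poly _ _)).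
have qc i : (i < 18)%N -> c i = c (18 + i %% 9)%N.
  move=> i18; have := congr1 (fun p : {poly rat} => p`_i) q0.
  by rewrite coef0 coef_poly i18 => /eqP; rewrite intr_eq0 subr_eq0 => /eqP.
move=> a a9; split.
  by rewrite qc ?(ltn_trans a9) // modn_small.
by rewrite qc ?(ltn_add2l 9 a 9) // modnDl modn_small.
Qed.

End Cyclic.

(* The adjacency operator commutes with right translations by the elementary  *)
(* abelian subgroup <y, z>; each of its characters contributes a 3 x 3 block  *)
(* with entries in Z[w], w^3 = 1.                                             *)
Lemma nc_spectrum_cubic (gT : finGroupType) c d (phi : nat -> gT) (S : {set gT}) z :
  coded (nc_op c d) phi -> z \in spectrum (adjacency_mx (Cay S)) ->
  exists2 M : 'M[algC]_3, root (char_poly M) z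
    & forall sigma : {rmorphism algC -> algC},
        (forall w, w ^+ 3 = 1 -> sigma w = w) -> map_mx sigma M = M.
Proof.
move=> cod; have val := valid_nc c d.
have [w prw] := C_prim_root_exists (isT : 0 < 3)%N.
have phi1 : phi 0 = 1%g := coded1 cod val.
have phiM a b : (a < 27)%N -> (b < 27)%N -> (phi a * phi b)%g = phi (nc_op c d a b).
  exact: codedM cod _ _.
have y2 : phi 6 = (phi 3 * phi 3)%g by rewrite phiM //; case: (c) (d) => [] [].
have y3 : (phi 3 ^+ 3 = 1)%g.
  by rewrite !expgS expg0 mulg1 -y2 phiM // -phi1; case: (c) (d) => [] [].
have z2 : phi 18 = (phi 9 * phi 9)%g by rewrite phiM //; case: (c) (d) => [] [].
have z3 : (phi 9 ^+ 3 = 1)%g.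
  by rewrite !expgS expg0 mulg1 -z2 phiM // -phi1; case: (c) (d) => [] [].
have yz : commute (phi 3) (phi 9).
  by rewrite /commute !phiM //; case: (c) (d) => [] [].
have yE b : (b < 3)%N -> phi (3 * b)%N = (phi 3 ^+ b)%g.
  by case: b => [|[|[|]]] //; rewrite ?expg1 ?phi1 // y2.
have zE b : (b < 3)%N -> phi (9 * b)%N = (phi 9 ^+ b)%g.
  by case: b => [|[|[|]]] //; rewrite ?expg1 ?phi1 // z2.
have phiE a : (a < 27)%N ->
    phi a = (phi (a %% 3)%N * phi 3 ^+ (a %/ 3 %% 3) * phi 9 ^+ (a %/ 9))%g.
  move=> a27; rewrite -yE ?ltn_pmod // -zE ?ltn_divLR //.
  have : all (fun a => [&& a %% 3 < 27, 3 * (a %/ 3 %% 3) < 27, 9 * (a %/ 9) < 27 &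
      nc_op c d (nc_op c d (a %% 3) (3 * (a %/ 3 %% 3))) (9 * (a %/ 9)) == a]%N) elts.
    by case: (c) (d) => [] []; vm_compute.
  move/allP/(_ a); rewrite mem_iota => /(_ a27)/and4P[h1 h2 h3 /eqP h4].
  by rewrite (phiM _ _ h1 h2) (phiM _ _ (op_lt val h1 h2) h3) h4.
case/spectrumP => v0 v0n v0S.
(* Twisting by z and then by y gives an eigenvector for both translations: y and z commute, so the
   second twist preserves what the first achieved. *)
have [j v1n] := twist_neq0 (phi 9) prw v0n.
have v1S := twist_eigen (phi 9) 2 (w ^+ j) v0S.
have wj3 i : w ^+ i ^+ 3 = 1 by rewrite exprAC (prim_expr_order prw) expr1n.
have v1z h := twistM z3 v0 h (wj3 j).
move: (twist _ _ _ _) v1n v1S v1z => v1 v1n v1S v1z.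
have [k vn] := twist_neq0 (phi 3) prw v1n.
have vS := twist_eigen (phi 3) 2 (w ^+ k) v1S.
have vy h := twistM y3 v1 h (wj3 k).
have vz := twist_commute 2 (w ^+ k) yz v1z.
move: (twist _ _ _ _) vn vS vy vz => v [x vx] vS vy vz.
move: (w ^+ j) (w ^+ k) (wj3 j) (wj3 k) vy vz => beta' alpha' b3 a3 vy vz.
(* Squares serve as inverses of these cube roots of unity. *)
pose alpha := alpha' ^+ 2; pose beta := beta' ^+ 2.
have vyE b h : v (h * phi 3 ^+ b)%g = alpha ^+ b * v h.
  elim: b => [|b IH]; first by rewrite mulg1 mul1r.
  by rewrite expgSr mulgA exprS -mulrA -IH -(vy (h * _)%g) mulrA -exprSr a3 mul1r.
have vzE b h : v (h * phi 9 ^+ b)%g = beta ^+ b * v h.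
  elim: b => [|b IH]; first by rewrite mulg1 mul1r.
  by rewrite expgSr mulgA exprS -mulrA -IH -(vz (h * _)%g) mulrA -exprSr b3 mul1r.
have vE a : (a < 27)%N ->
    v (phi a) = beta ^+ (a %/ 9) * (alpha ^+ (a %/ 3 %% 3) * v (phi (a %% 3)%N)).
  by move=> a27; rewrite {1}phiE // vzE vyE.
(* [v] is determined by its values at 1, x and x^2; [M] is the adjacency operator in these three
   coordinates. *)
pose M : 'M[algC]_3 := \matrix_(i, j) \sum_(a <- elts)
  ((phi a \in S) && (nc_op c d a j %% 3 == i)%N)%:R
  * (beta ^+ (nc_op c d a j %/ 9) * alpha ^+ (nc_op c d a j %/ 3 %% 3)).
exists M.
  rewrite -eigenvalue_root_char; apply/eigenvalueP.
  exists (\row_i v (phi i)); last first.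
    have [a a27 xE] := coded_surj cod x.
    apply/rV0Pn; exists (inord (a %% 3)); rewrite mxE inordK ?ltn_pmod //.
    by apply: contraNneq vx => v0a; rewrite -xE vE // v0a !mulr0.
  apply/rowP => l; rewrite !mxE -vS (sum_Cay _ _ _ cod).
  under eq_bigr => i _ do rewrite !mxE mulr_sumr.
  rewrite exchange_big; apply: eq_big_seq => a; rewrite mem_iota => a27.
  have l27 : (l < 27)%N by apply: ltn_trans (ltn_ord l) _.
  rewrite (phiM _ _ a27 l27) (vE _ (op_lt val a27 l27)).
  rewrite (bigD1 (inord (nc_op c d a l %% 3))) //= inordK ?ltn_pmod //.
  rewrite eqxx andbT big1 ?addr0 => [|i il].
    by rewrite mulrC -!mulrA.
  rewrite (_ : (_ == nat_of_ord i) = false) ?andbF ?mul0r ?mulr0 //.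
  apply: contraNF il => /eqP il; apply/eqP/val_inj.
  by rewrite /= inordK ?ltn_pmod // il.
move=> sigma fix3; apply/matrixP => i l; rewrite !mxE rmorph_sum.
apply: eq_bigr => a _; rewrite rmorphM rmorph_nat rmorphM !rmorphXn /=.
by rewrite !fix3 // exprAC ?a3 ?b3 expr1n.
Qed.

End Eigenvalues.

(** [sigma] permutes the roots of the cubic, and the orbit of [z] has length dividing 9; having at
    most three elements, it has length 1 or 3. *)
Lemma cubic_orbit (M : 'M[algC]_3) (sigma : {rmorphism algC -> algC}) z :
  root (char_poly M) z -> map_mx sigma M = M -> iter 9 sigma z = z ->
  iter 3 sigma z = z.
Proof.
move=> rz fixM z9; have rs y : root (char_poly M) y -> root (char_poly M) (sigma y).
  by rewrite -[in X in _ -> X]fixM -map_char_poly fmorph_root.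
have inj := fmorph_inj sigma.
have [s1|n1] := eqVneq (sigma z) z; first by rewrite /= !s1.
have [s2|n2] := eqVneq (sigma (sigma z)) z.
  by move: z9; rewrite /= !s2 => /eqP; rewrite (negPf n1).
have [//|n3] := eqVneq (iter 3 sigma z) z.
have u : uniq [:: z; sigma z; sigma (sigma z); sigma (sigma (sigma z))].
  rewrite /= !inE !(inj_eq inj) !(eq_sym z).
  by rewrite (negPf n1) (negPf n2) (negPf n3).
have := max_poly_roots (monic_neq0 (char_poly_monic M)) _ u.
by rewrite size_char_poly /= rz !rs // => /(_ isT).
Qed.

Lemma mem_adj (gT : finGroupType) (phi : nat -> gT) (S : {set gT}) a :
  coded C27_op phi -> connection_set S -> a < 27 ->
  (phi a \in S) = adj C27_diff (bits C27_op phi S) a 0.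
Proof.
move=> cod conS a27; rewrite -C27_diffE.
rewrite -(Cay_adj cod valid_C27 conS a27 (isT : 0 < 27)).
by rewrite CayE (coded1 cod valid_C27) invg1 mulg1.
Qed.

(** The hypothesis says that the indicator at a minus that at 19 a is constant on cosets of <9>.
    Outside <3>, multiplication by 19 permutes such a coset cyclically, so the constant is 0 and the
    coset is full or empty. *)
Lemma adj_fixed_fibred b : size b = 13 ->
  (forall a, a < 9 ->
     adj C27_diff b a 0 + adj C27_diff b (19 * (18 + a) %% 27) 0
     = adj C27_diff b (18 + a) 0 + adj C27_diff b (19 * a %% 27) 0
  /\ adj C27_diff b (9 + a) 0 + adj C27_diff b (19 * (18 + a) %% 27) 0
     = adj C27_diff b (18 + a) 0 + adj C27_diff b (19 * (9 + a) %% 27) 0) ->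
  fibred b.
Proof.
pose test b a :=
  (adj C27_diff b a 0 + adj C27_diff b (19 * (18 + a) %% 27) 0
     == adj C27_diff b (18 + a) 0 + adj C27_diff b (19 * a %% 27) 0) &&
  (adj C27_diff b (9 + a) 0 + adj C27_diff b (19 * (18 + a) %% 27) 0
     == adj C27_diff b (18 + a) 0 + adj C27_diff b (19 * (9 + a) %% 27) 0).
have: allbits 13 (fun b => if allc (test b) (iota 0 9) then fibred b else true).
  by vm_compute.
move=> /allbitsP h b13 fixb; have := h b b13.
rewrite (_ : allc _ _ = true) // allcE; apply/allP => a.
by rewrite mem_iota => /fixb[/eqP h1 /eqP h2]; apply/andP.
Qed.

Lemma adj_fibred b : size b = 13 -> fibred b ->
  forall a, a < 27 -> adj C27_diff b (19 * a %% 27) 0 = adj C27_diff b a 0.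
Proof.
have: allbits 13 (fun b => if fibred b then
    allc (fun a => adj C27_diff b (19 * a %% 27) 0 == adj C27_diff b a 0) elts
    else true) by vm_compute.
move=> /allbitsP h b13 fb a a27; have := h b b13; rewrite fb allcE.
by move/allP/(_ a); rewrite mem_iota => /(_ a27)/eqP.
Qed.

(** * The Galois action zeta |-> zeta^4 on character sums *)

Section Galois.

Variable zeta : algC.
Hypothesis pr_zeta : (27.-primitive_root zeta)%R.
Variable sigma : {rmorphism algC -> algC}.
Hypothesis sigmaE : forall w : algC, (w ^+ 27 = 1 -> sigma w = w ^+ 4)%R.

Local Notation char_sum := (char_sum zeta).

Lemma char_sum_mul e k m j :
  perm_eq elts [seq m * b %% 27 | b <- elts] -> k * m = 1 %[mod 27] ->
  char_sum e (k * j) = char_sum (fun b => e (m * b %% 27)) j.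
Proof.
move=> pm km; rewrite /char_sum (perm_big _ pm) big_map /=.
apply: eq_bigr => b _; congr (_ * _)%R.
rewrite -(prim_expr_mod pr_zeta) modnMmr -(prim_expr_mod pr_zeta (j * b)).
by rewrite mulnACA -modnMml km modnMml mul1n.
Qed.

Lemma sigma_char_sum n e k :
  iter n sigma (char_sum e k) = char_sum e (4 ^ n * k).
Proof.
elim: n => [|n IH]; first by rewrite mul1n.
rewrite iterS IH rmorph_sum; apply: eq_bigr => a _; rewrite rmorphM rmorph_nat.
rewrite sigmaE -?exprM; first by congr (_ * _ ^+ _)%R; rewrite mulnC expnS !mulnA.
by rewrite mulnC exprM (prim_expr_order pr_zeta) expr1n.
Qed.

Lemma char_sum_eq_mod e k l : k = l %[mod 27] -> char_sum e k = char_sum e l.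
Proof. by move=> kl; rewrite -(char_sum_mod pr_zeta) kl char_sum_mod. Qed.

(** This is [zeta_free] for the difference of the indicator functions, with subtractions moved
    across to stay in the natural numbers. *)
Lemma char_sum_free (e f : nat -> bool) : char_sum e 1 = char_sum f 1 ->
  forall a, a < 9 -> e a + f (18 + a) = e (18 + a) + f a
                  /\ e (9 + a) + f (18 + a) = e (18 + a) + f (9 + a).
Proof.
move=> ef a a9.
have /(zeta_free pr_zeta)/(_ a a9)[h1 h2] :
    (\sum_(b <- elts) ((e b)%:R - (f b)%:R : int)%:~R * zeta ^+ b = 0)%R.
  apply: (@etrans _ _ (char_sum e 1 - char_sum f 1)%R); last by rewrite ef subrr.
  rewrite /char_sum -sumrB.
  by apply: eq_bigr => b _; rewrite mul1n -mulrBl rmorphB /= !natz !pmulrn.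
have aux (p q r s : bool) : (p%:R - q%:R = r%:R - s%:R :> int)%R -> p + s = r + q.
  by case: p; case: q; case: r; case: s.
by split; apply: aux.
Qed.

Section Cyclic27.

Variables (gT : finGroupType) (phi : nat -> gT) (S : {set gT}).
Hypotheses (cod : coded C27_op phi) (conS : connection_set S).

Local Notation e := (fun a => phi a \in S).

(** 64 = 4^3 is the exponent of sigma^3 and 19 is its inverse modulo 27, so [S] is compared with a
    multiple of itself at the same primitive character. *)
Lemma fixed_fibred : char_sum e 64 = char_sum e 1 -> fibred (bits C27_op phi S).
Proof.
rewrite -[64]muln1 (@char_sum_mul _ 64 19) //.
move=> /esym/char_sum_free h; apply: adj_fixed_fibred.
  exact: (size_bits phi valid_C27 S).
have lt27 n : 19 * n %% 27 < 27 by rewrite ltn_pmod.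
move=> a a9; have [h1 h2] := h a a9.
have a27 : a < 27 by apply: ltn_trans a9 _.
have a27' : 9 + a < 27 by rewrite (@ltn_trans 18) // (ltn_add2l 9 a 9).
have a27'' : 18 + a < 27 by rewrite (ltn_add2l 18 a 9).
by rewrite -!(mem_adj cod conS).
Qed.

Lemma fibred_fixed k : fibred (bits C27_op phi S) ->
  char_sum e (64 * k) = char_sum e k.
Proof.
move=> fS; rewrite (@char_sum_mul _ 64 19) //.
apply: eq_big_seq => a; rewrite mem_iota => a27; congr (_%:R * _)%R.
rewrite !(mem_adj cod conS) ?ltn_pmod //.
by rewrite (adj_fibred (size_bits phi valid_C27 S)).
Qed.

End Cyclic27.

(** [cubic_orbit] applies because 4 = 1 modulo 3, so [sigma] fixes the cube roots of unity, and 4^9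
    = 1 modulo 27. *)
Lemma nc_cospectral_fibred (gT hT : finGroupType) (phi : nat -> gT) c d
    (psi : nat -> hT)    (S : {set gT}) (S' : {set hT}) :
  coded C27_op phi -> coded (nc_op c d) psi -> connection_set S ->
  cospectral (Cay S) (Cay S') -> fibred (bits C27_op phi S).
Proof.
move=> cod cod' conS /perm_mem SS'; apply: (fixed_fibred cod conS).
have := C27_spectrum pr_zeta cod S 1; rewrite SS'.
case/(nc_spectrum_cubic cod') => M rM fixM.
rewrite -[in RHS](cubic_orbit rM (sigma := sigma)) ?sigma_char_sum //.
  apply: fixM => w w3; rewrite sigmaE; last by rewrite -[27]/(3 * 9) exprM w3 expr1n.
  by rewrite exprS w3 mulr1.
by apply: char_sum_eq_mod.
Qed.

Lemma C27_cospectral_fibred (gT hT : finGroupType) (phi : nat -> gT) (psi : nat -> hT)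
    (S : {set gT}) (S' : {set hT}) :
  coded C27_op phi -> coded C27_op psi -> connection_set S -> connection_set S' ->
  cospectral (Cay S) (Cay S') ->
  fibred (bits C27_op phi S) -> fibred (bits C27_op psi S').
Proof.
move=> cod cod' conS conS' /perm_mem SS' fS; apply: (fixed_fibred cod' conS').
have := C27_spectrum pr_zeta cod' S' 1; rewrite -SS'.
case/(C27_spectrumP pr_zeta cod) => k kE.
have : iter 3 sigma (char_sum (fun a => psi a \in S') 1)
     = iter 3 sigma (char_sum (fun a => phi a \in S) k) by rewrite kE.
by rewrite !sigma_char_sum kE => ->; apply: fibred_fixed.
Qed.

(** If 3 divides [k], then sigma^3 fixes zeta^k, hence the common eigenvalue, and [S] would be
    fibred. *)
Lemma C27_cospectral_unit (gT hT : finGroupType) (phi : nat -> gT) (psi : nat -> hT)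
    (S : {set gT}) (S' : {set hT}) :
  coded C27_op phi -> coded C27_op psi -> connection_set S ->
  cospectral (Cay S) (Cay S') -> ~~ fibred (bits C27_op phi S) ->
  exists2 k, ~~ (3 %| k)
    & char_sum (fun a => phi a \in S) 1 = char_sum (fun a => psi a \in S') k.
Proof.
move=> cod cod' conS /perm_mem SS' nfS.
have := C27_spectrum pr_zeta cod S 1; rewrite SS'.
case/(C27_spectrumP pr_zeta cod') => k kE.
exists k => //; apply: contra nfS => /dvdnP[l lE]; apply: (fixed_fibred cod conS).
have : iter 3 sigma (char_sum (fun a => phi a \in S) 1)
     = iter 3 sigma (char_sum (fun a => psi a \in S') k) by rewrite kE.
rewrite !sigma_char_sum kE => ->; apply: char_sum_eq_mod.
rewrite lE -[4 ^ 3]/(63 + 1) mulnDl mul1n mulnCA -[63 * 3]/(7 * 27).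
by rewrite mulnA modnMDl.
Qed.

End Galois.

Lemma coset_bits (p q r p' q' r' : bool) :
  p + r' = r + p' -> q + r' = r + q' ->
  [\/ [/\ p' = p, q' = q & r' = r],
      [/\ p = true, q = true & r = true] /\ [/\ p' = false, q' = false & r' = false]
    | [/\ p = false, q = false & r = false] /\ [/\ p' = true, q' = true & r' = true]].
Proof.
by case: p; case: q; case: r; case: p'; case: q'; case: r' => // _ _;
  [constructor 1 | constructor 2 | constructor 1 | constructor 1 | constructor 1
  | constructor 1 | constructor 1 | constructor 1 | constructor 3 | constructor 1].
Qed.

Lemma flip_cosets_exists b b' : size b = 13 -> size b' = 13 ->
  (forall a, a < 9 ->
     adj C27_diff b a 0 + adj C27_diff b' (18 + a) 0
     = adj C27_diff b (18 + a) 0 + adj C27_diff b' a 0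
  /\ adj C27_diff b (9 + a) 0 + adj C27_diff b' (18 + a) 0
     = adj C27_diff b (18 + a) 0 + adj C27_diff b' (9 + a) 0) ->
  exists2 m, size m = 4 & b' = flip_cosets b m.
Proof.
case: b => [|b0 [|b1 [|b2 [|b3 [|b4 [|b5 [|b6 [|b7
  [|b8 [|b9 [|b10 [|b11 [|b12 [|]]]]]]]]]]]]]] //= _.
case: b' => [|c0 [|c1 [|c2 [|c3 [|c4 [|c5 [|c6 [|c7
  [|c8 [|c9 [|c10 [|c11 [|c12 [|]]]]]]]]]]]]]] //= _ h.
have [h0 _] := h 0 isT; have [h1 h1'] := h 1 isT; have [h2 h2'] := h 2 isT.
have [h3 h3'] := h 3 isT; have [h4 h4'] := h 4 isT.
move: h0 h1 h1' h2 h2' h3 h3' h4 h4' {h}; rewrite /adj /= => h0.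
(* The coset <9> contains 0, which is in neither set, so the bits of {9, -9} agree. *)
have {h0} <- : b8 = c8 by case: b8 c8 h0 => [] [].
move=> /coset_bits h1 /h1{h1} h1 /coset_bits h2 /h2{h2} h2.
move=> /coset_bits h3 /h3{h3} h3 /coset_bits h4 /h4{h4} h4.
(* The order follows [coset_pairs], where the coset of 4 precedes that of 3. *)
exists [:: b0 (+) c0; b1 (+) c1; b3 (+) c3; b2 (+) c2] => //.
by case: h1 => [[-> -> ->]|[[-> -> ->] [-> -> ->]]|[[-> -> ->] [-> -> ->]]];
   case: h2 => [[-> -> ->]|[[-> -> ->] [-> -> ->]]|[[-> -> ->] [-> -> ->]]];
   case: h3 => [[-> -> ->]|[[-> -> ->] [-> -> ->]]|[[-> -> ->] [-> -> ->]]];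
   case: h4 => [[-> -> ->]|[[-> -> ->] [-> -> ->]]|[[-> -> ->] [-> -> ->]]];
   rewrite /flip_cosets /full_or_empty /= ?addbb /= ?addbF.
Qed.

(** * Cospectral mates of graphs on C27 *)

Section Sufficiency.

Variables (gT : finGroupType) (phi : nat -> gT) (S : {set gT}).
Hypotheses (cod : coded C27_op phi) (conS : connection_set S).

Local Notation bS := (bits C27_op phi S).

Lemma C27_walks_key (hT : finGroupType) op psi (S' : {set hT}) :
  coded op psi -> valid_op op -> connection_set S' ->
  (forall k, walks (Cay S) k 1%g 1%g = walks (Cay S') k 1%g 1%g) ->
  key C27_pairs bS = key (pair_table op (diff_table op)) (bits op psi S').
Proof.
move=> cod' val' conS' SS'; rewrite -C27_pairsE -C27_diffE.
exact: (walks_key cod valid_C27 cod' val' conS conS' SS').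
Qed.

Lemma fibred_gamma : fibred bS -> exists2 b0, b0 \in gammas
  & key C27_pairs b0 = key C27_pairs bS
    /\ graph_iso (Cay (bset C27_op phi b0)) (Cay S).
Proof.
move=> fS; have b13 := size_bits phi valid_C27 S.
have [b0 b0g eqk] := fibred_key b13 fS; exists b0; first exact: b0g.
split; first exact: eqk.
have s0 := size_gamma b0g; have con0 := bset_connection cod valid_C27 s0.
have [f frf isof] := C27_rigid_iso b13 fS b0g eqk.
apply: (frame_iso_Cay cod valid_C27 cod valid_C27 con0 conS frf).
by rewrite (bsetK cod valid_C27 s0) C27_diffE.
Qed.

Lemma fibred_nc_iso (hT : finGroupType) c d (psi : nat -> hT) (S' : {set hT}) :
  coded (nc_op c d) psi -> connection_set S' -> fibred bS ->
  cospectral (Cay S) (Cay S') -> graph_iso (Cay S) (Cay S').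
Proof.
move=> cod' conS' fS cosp; have val' := valid_nc c d.
have [b0 b0g [eqk /graph_iso_sym isoS]] := fibred_gamma fS.
apply: (graph_iso_trans isoS).
have s0 := size_gamma b0g; have con0 := bset_connection cod valid_C27 s0.
have eqk' := C27_walks_key cod' val' conS' (fun k => cospectral_walks_Cay k cosp).
rewrite -eqk nc_diffE nc_pairsE in eqk'.
have [f frf isof] := nc_rigid_iso (size_bits psi val' S') b0g eqk'.
apply: (frame_iso_Cay cod valid_C27 cod' val' con0 conS' frf).
by rewrite (bsetK cod valid_C27 s0) C27_diffE nc_diffE.
Qed.

Lemma fibred_C27_iso (hT : finGroupType) (psi : nat -> hT) (S' : {set hT}) :
  coded C27_op psi -> connection_set S' -> fibred bS ->
  fibred (bits C27_op psi S') ->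
  cospectral (Cay S) (Cay S') -> graph_iso (Cay S) (Cay S').
Proof.
move=> cod' conS' fS fS' cosp.
have [b0 b0g [eqk /graph_iso_sym isoS]] := fibred_gamma fS.
apply: (graph_iso_trans isoS).
have s0 := size_gamma b0g; have con0 := bset_connection cod valid_C27 s0.
have eqk' := C27_walks_key cod' valid_C27 conS' (fun k => cospectral_walks_Cay k cosp).
rewrite -eqk C27_diffE C27_pairsE in eqk'.
have [f frf isof] := C27_rigid_iso (size_bits psi valid_C27 S') fS' b0g eqk'.
apply: (frame_iso_Cay cod valid_C27 cod' valid_C27 con0 conS' frf).
by rewrite (bsetK cod valid_C27 s0) C27_diffE.
Qed.

End Sufficiency.

Section PowerMap.

Variables (gT : finGroupType) (phi : nat -> gT).
Hypothesis cod : coded C27_op phi.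

Lemma C27_phiX a k : a < 27 -> (phi a ^+ k)%g = phi (k * a %% 27).
Proof.
move=> a27; elim: k => [|k IH]; first by rewrite (coded1 cod valid_C27).
rewrite expgS IH (codedM cod) // ?ltn_pmod //.
by rewrite /C27_op modnDmr mulSn.
Qed.

Lemma C27_expMg (x y : gT) k : ((x * y) ^+ k = x ^+ k * y ^+ k)%g.
Proof.
apply: expgMn; have [a a27 <-] := coded_surj cod x.
have [b b27 <-] := coded_surj cod y.
by rewrite /commute !(codedM cod) // /C27_op addnC.
Qed.

Lemma C27_expg27 (x : gT) k l : k = l %[mod 27] -> (x ^+ k = x ^+ l)%g.
Proof.
have x27 : (x ^+ 27 = 1)%g by rewrite -(coded_card cod) -cardsT expg_cardG ?inE.
by move=> kl; rewrite -(expg_mod k x27) kl expg_mod.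
Qed.

Lemma C27_power_iso (S : {set gT}) k l : k * l = 1 %[mod 27] ->
  perm_eq elts [seq l * b %% 27 | b <- elts] -> connection_set S ->
  exists2 S' : {set gT}, connection_set S' & [/\ graph_iso (Cay S) (Cay S'),
    (forall n, walks (Cay S) n 1%g 1%g = walks (Cay S') n 1%g 1%g) &
    forall zeta, (27.-primitive_root zeta)%R ->
      char_sum zeta (fun a => phi a \in S) k
      = char_sum zeta (fun a => phi a \in S') 1].
Proof.
move=> kl perml [S1 SV]; pose S' := [set x : gT | (x ^+ l)%g \in S].
have conS' : connection_set S'.
  split; first by rewrite inE expg1n.
  by apply/setP => x; rewrite !inE expgVn -mem_invg SV.
have lk : (fun x : gT => x ^+ k ^+ l)%g =1 id.
  by move=> x; rewrite -expgM (C27_expg27 x kl).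
have bk : bijective (fun x : gT => (x ^+ k)%g).
  exists (fun x => (x ^+ l)%g) => x; first exact: lk.
  by rewrite -expgM mulnC (C27_expg27 x kl).
have Cayk x y : Cay S' (x ^+ k)%g (y ^+ k)%g = Cay S x y.
  rewrite !CayE inE -expgVn -C27_expMg.
  by rewrite [X in X \in _ = _](lk (x * y^-1)%g).
exists S' => //; split.
- by exists (fun x => x ^+ k)%g.
- by move=> n; rewrite -(walks_bij n 1%g 1%g bk Cayk) expg1n.
move=> zeta prz; rewrite -[k in LHS]muln1 (char_sum_mul prz _ _ perml kl).
apply: eq_big_seq => a; rewrite mem_iota => a27.
by rewrite inE C27_phiX.
Qed.

End PowerMap.

Lemma unit27_inverse k : ~~ (3 %| k) ->
  exists2 l, k * l = 1 %[mod 27] & perm_eq elts [seq l * b %% 27 | b <- elts].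
Proof.
move=> k3; have: all (fun k => (3 %| k) || has (fun l => (k * l == 1 %[mod 27]) &&
    perm_eq elts [seq l * b %% 27 | b <- elts]) elts) elts by vm_compute.
move/allP/(_ (k %% 27)); rewrite mem_iota ltn_pmod // => /(_ isT).
rewrite [in 3 %| _](_ : (3 %| k %% 27) = (3 %| k)); last first.
  by rewrite /dvdn modn_dvdm.
rewrite (negPf k3) => /hasP[l _ /andP[/eqP kl pl]]; exists l => //.
by rewrite -kl modnMml.
Qed.

Lemma C27_CayDS (gT : finGroupType) (phi : nat -> gT) (S : {set gT})
    (hT : finGroupType) (S' : {set hT}) :
  coded C27_op phi -> connection_set S -> connection_set S' ->
  (exists psi : nat -> hT, coded C27_op psi)
    \/ (exists c d, exists psi : nat -> hT, coded (nc_op c d) psi) ->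
  cospectral (Cay S) (Cay S') -> graph_iso (Cay S) (Cay S').
Proof.
move=> cod conS conS'; have [zeta prz] := C_prim_root_exists (isT : 0 < 27).
have [sigma sE] := @Qn_aut_exists 4 27 isT.
case=> [[psi cod']|[c [d [psi cod']]]] cosp; last first.
  have fS := nc_cospectral_fibred prz sE cod cod' conS cosp.
  exact: (fibred_nc_iso cod conS cod' conS' fS cosp).
have [fS|nfS] := boolP (fibred (bits C27_op phi S)).
  have fS' := C27_cospectral_fibred prz sE cod cod' conS conS' cosp fS.
  exact: (fibred_C27_iso cod conS cod' conS' fS fS' cosp).
have [k k3 eqz] := C27_cospectral_unit prz sE cod cod' conS cosp nfS.
have [l kl perml] := unit27_inverse k3.
(* The power map carries the eigenvalue of [S'] at the character [k] to the character 1, where it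
   can be compared with that of [S]. *)
have [S2 con2 [iso2 walks2 z2]] := C27_power_iso cod' kl perml conS'.
have eqk : key C27_pairs (bits C27_op phi S) = key C27_pairs (bits C27_op psi S2).
  rewrite (C27_walks_key cod conS cod' valid_C27 con2) ?C27_diffE ?C27_pairsE //.
  by move=> n; rewrite (cospectral_walks_Cay n cosp) walks2.
rewrite z2 // in eqz.
have bS := size_bits phi valid_C27 S; have bS2 := size_bits psi valid_C27 S2.
have [|m m4 flip] := flip_cosets_exists bS bS2.
  move=> a a9; have [h1 h2] := char_sum_free prz eqz a9.
  have a27 : a < 27 by apply: ltn_trans a9 _.
  have a27' : 9 + a < 27 by rewrite (@ltn_trans 18) // (ltn_add2l 9 a 9).
  have a27'' : 18 + a < 27 by rewrite (ltn_add2l 18 a 9).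
  by rewrite -!(mem_adj cod conS) // -!(mem_adj cod' con2).
have eqb : bits C27_op psi S2 = bits C27_op phi S.
  rewrite flip; apply: (flip_cosets_id bS m4 nfS).
  by rewrite -flip eqk.
apply: (graph_iso_trans _ (graph_iso_sym iso2)).
apply: (@frame_iso_Cay _ _ _ _ _ _ _ _ elts cod valid_C27 cod' valid_C27 conS con2) => //.
rewrite eqb /frame_iso allcE; apply/allP => a; rewrite mem_iota => a27.
rewrite allcE; apply/allP => b; rewrite mem_iota => b27.
by rewrite !nth_iota.
Qed.

(** * The groups of order 27 *)

Section Order27.

Variable gT : finGroupType.
Hypothesis card27 : #|gT| = 27.
Local Open Scope group_scope.

Lemma cyclic_coded : cyclic [set: gT] -> exists phi : nat -> gT, coded C27_op phi.
Proof.
case/cyclicP => g defG; have og : #[g] = 27 by rewrite orderE -defG cardsT.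
exists (fun a => g ^+ a); split=> // [h|a b _ _].
  have /cyclePmin[a] : h \in <[g]> by rewrite -defG inE.
  by rewrite og => a27 ->; exists a.
by rewrite -expgD /C27_op -og expg_mod_order.
Qed.

(** Products are collected into normal form: y^j x^i = x^i y^j z^(c j i), and the carry of the
    exponent of x goes to z by x^3 = z^d. *)
Lemma nc_coded (c d : bool) (x y z : gT) :
    z ^+ 3 = 1 -> y ^+ 3 = 1 -> x ^+ 3 = z ^+ d -> y * x = x * y * z ^+ c ->
    commute z x -> commute z y ->
    (forall g, exists i j k, g = x ^+ i * y ^+ j * z ^+ k) ->
  exists phi : nat -> gT, coded (nc_op c d) phi.
Proof.
move=> z3 y3 x3 yx zx zy surj.
pose phi n := x ^+ (n %% 3)%N * y ^+ (n %/ 3 %% 3)%N * z ^+ (n %/ 9)%N.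
have digits i j k : (i < 3 -> j < 3 -> k < 3 ->
    [/\ (i + 3 * j + 9 * k) %% 3 = i, (i + 3 * j + 9 * k) %/ 3 %% 3 = j,
        (i + 3 * j + 9 * k) %/ 9 = k & i + 3 * j + 9 * k < 27])%N.
  by case: i => [|[|[|]]] //; case: j => [|[|[|]]] //; case: k => [|[|[|]]].
have phiE i j k : (i < 3 -> j < 3 -> k < 3 ->
    phi (i + 3 * j + 9 * k)%N = (x ^+ i * y ^+ j * z ^+ k)%g)%N.
  by move=> i3 j3 k3; rewrite /phi; have [-> -> -> _] := digits i j k i3 j3 k3.
have norm i j k : x ^+ i * y ^+ j * z ^+ k
    = phi (i %% 3 + 3 * (j %% 3) + 9 * ((k + d * (i %/ 3)) %% 3))%N.
  rewrite phiE ?ltn_pmod // (expg_mod _ z3) (expg_mod _ y3).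
  rewrite {1}(divn_eq i 3) addnC expgD mulnC expgM x3 -expgM.
  rewrite -!mulgA; congr (_ * _); rewrite addnC expgD mulgA.
  rewrite [in RHS]mulgA; congr (_ * _).
  exact: (commuteX2 _ _ zy).
have zX i : commute (z ^+ i) x by apply/commute_sym/commuteX/commute_sym.
have yjx j : y ^+ j * x = x * y ^+ j * z ^+ (c * j).
  elim: j => [|j IH]; first by rewrite muln0 !mul1g !mulg1.
  rewrite expgSr -mulgA yx !mulgA IH mulnS addnC expgD !mulgA; congr (_ * _).
  by rewrite -!mulgA; congr (_ * (_ * _)); apply: (commuteX2 _ 1 zy).
have yjxi i j : y ^+ j * x ^+ i = x ^+ i * y ^+ j * z ^+ (c * (j * i)).
  elim: i => [|i IH]; first by rewrite !muln0 !mulg1 mul1g.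
  rewrite expgSr mulgA IH -!mulgA zX !mulgA -(mulgA _ _ x) yjx !mulgA.
  by rewrite -!mulgA -expgD mulnS mulnDr addnC.
exists phi; split=> // [g|a b a27 b27].
  have [i [j [k ->]]] := surj g; rewrite norm; eexists; last by [].
  by have [] := digits (i %% 3)%N (j %% 3)%N ((k + d * (i %/ 3)) %% 3)%N;
    rewrite ?ltn_pmod.
rewrite {1 2}/phi /nc_op.
set i := (a %% 3)%N; set j := (a %/ 3 %% 3)%N; set k := (a %/ 9)%N.
set i' := (b %% 3)%N; set j' := (b %/ 3 %% 3)%N; set k' := (b %/ 9)%N.
have -> : x ^+ i * y ^+ j * z ^+ k * (x ^+ i' * y ^+ j' * z ^+ k')
    = x ^+ (i + i') * y ^+ (j + j') * z ^+ (k + k' + c * (j * i')).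
  have e1 : z ^+ k * (x ^+ i' * y ^+ j') = x ^+ i' * y ^+ j' * z ^+ k.
    exact: commuteM (commuteX2 k i' zx) (commuteX2 k j' zy).
  rewrite mulgA -(mulgA _ (z ^+ k)) e1 !mulgA -(mulgA _ (y ^+ j)) yjxi !mulgA.
  rewrite -(mulgA _ (z ^+ _) (y ^+ j')) (commuteX2 (c * (j * i')) j' zy) !mulgA.
  rewrite -expgD -(mulgA _ (y ^+ j) (y ^+ j')) -expgD -!mulgA -!expgD.
  by rewrite [X in _ * (_ * _ ^+ X) = _]addnC.
by rewrite norm /j /j' modnDm.
Qed.

(** A noncyclic 3-group of odd order has rank at least 2, hence an elementary abelian subgroup [E]
    of order 9, normal of index 3. Take [x] outside [E], [z] central in [E] with x^3 equal to 1 or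
    [z], and [y] in [E] outside <z>. As G/<z> has order 9, it is abelian, so [y, x] is a power of
    [z]. *)
Lemma noncyclic_coded : ~~ cyclic [set: gT] ->
  exists c d, exists phi : nat -> gT, coded (nc_op c d) phi.
Proof.
move=> ncG; pose G := [set: gT]%G.
have oG : #|G| = 27 by rewrite cardsT.
have pG : 3.-group G by rewrite /pgroup oG.
have nilG := pgroup_nil pG.
have /p_rank_geP[E /pnElemPcard[sEG abelE oE]] : 1 < 'r_3(G).
  by rewrite ltnNge -(odd_pgroup_rank1_cyclic pG) ?oG.
have abE : abelian E := abelem_abelian abelE.
have expE u : u \in E -> u ^+ 3 = 1.
  by move=> Eu; have [_ /(_ u Eu)] := (abelemP (isT : prime 3) abelE).
have full (H : {group gT}) u : E \subset H -> u \in H -> u \notin E -> H = G.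
  move=> sEH Hu nEu; apply/val_inj/eqP; rewrite /= eqEcard subsetT cardsT card27 /=.
  have ltH : #|E| < #|H|.
    apply: proper_card; rewrite properE sEH.
    by apply: contra nEu => /subsetP; apply.
  have : #|H| %| 27 by rewrite -oG cardSg ?subsetT.
  rewrite oE in ltH; case/(dvdn_pfactor _ 3 (isT : prime 3)) => m m3 oH.
  by rewrite oH; move: m m3 oH ltH => [|[|[|[|]]]] // _ ->.
have nsEG : E <| G.
  apply: (p_maximal_normal pG); apply: p_index_maximal => //.
  by rewrite -divgS // oG oE.
have [x nEx] : exists x, x \notin E.
  apply/existsP; apply: contraT; rewrite negb_exists => /forallP EG.
  have : G \subset E by apply/subsetP => u _; move: (EG u); rewrite negbK.
  by move/subset_leq_card; rewrite oG oE.
have Ex3 : x ^+ 3 \in E.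
  have NE u : u \in 'N(E) by rewrite (subsetP (normal_norm nsEG)) ?inE.
  apply: coset_idr => //; rewrite morphX ?NE //.
  have <- : #|G / E| = 3 by rewrite card_quotient ?normal_norm // -divgS // oG oE.
  by rewrite expg_cardG // mem_quotient ?inE.
have [d [z [Ez z1 x3 cz]]] : exists (d : bool) z,
    [/\ z \in E, z != 1, x ^+ 3 = z ^+ d & forall u, commute z u].
  have [x31|x31] := eqVneq (x ^+ 3) 1.
    have := meet_center_nil nilG nsEG; rewrite -cardG_gt1 oE => /(_ isT).
    case/trivgPn => z /setIP[Ez /centerP[_ cz]] z1; exists false, z; split=> //.
    by move=> u; apply: cz; rewrite inE.
  exists true, (x ^+ 3); split=> // u; apply/cent1P; rewrite cent1C.
  have /(congr1 (@gval gT))/= -> : 'C[x ^+ 3]%G = G; last by rewrite inE.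
  apply: (full _ x) nEx; first by rewrite sub_cent1 (subsetP abE).
  exact/cent1P/commuteX.
have oz : #[z] = 3.
  by apply/nt_prime_order => //; apply: expE.
have [y Ey nzy] : exists2 y, y \in E & y \notin <[z]>.
  apply/subsetPn; apply: contraL (isT : 3 < 9) => /subset_leq_card.
  by rewrite oE -orderE oz.
have oy : #[y] = 3.
  apply/nt_prime_order => //; first exact: expE.
  by apply: contraNneq nzy => ->; rewrite group1.
have [m m3 yx] : exists2 m, m < 3 & y * x = x * y * z ^+ m.
  have nZ : G \subset 'N(<[z]>).
    rewrite cents_norm // centsC cycle_subG; apply/centP => u _; exact: cz.
  have abQ : abelian (G / <[z]>).
    apply: (p2group_abelian (quotient_pgroup _ pG)).
    by rewrite card_quotient // -divgS ?subsetT // oG -orderE oz.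
  have : [~ y, x] \in <[z]>.
    by apply: (subsetP (der1_min nZ abQ)); rewrite mem_commg ?inE.
  case/cyclePmin => m; rewrite oz => m3 yxE; exists m => //.
  by rewrite commgC yxE.
have defE : E :=: <[y]> * <[z]>.
  apply/esym/eqP; rewrite eqEcard mul_subG ?cycle_subG //=.
  by rewrite TI_cardMg ?prime_TIg -?orderE ?oy ?cycle_subG ?oz ?oE.
have surj y' : <[y']> = <[y]> ->
    forall g, exists i j k, g = x ^+ i * y' ^+ j * z ^+ k.
  move=> yy' g; have : g \in <[x]> <*> E.
    have /(congr1 (@gval gT))/= -> : (<[x]> <*> E)%G = G; last by rewrite inE.
    by apply: (full _ x) nEx; rewrite ?joing_subr // mem_gen // inE cycle_id.
  rewrite norm_joinEl; last first.
    by rewrite cycle_subG (subsetP (normal_norm nsEG)) ?inE.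
  case/mulsgP => u v /cycleP[i ->]; rewrite defE -yy'.
  case/mulsgP => s t /cycleP[j ->] /cycleP[k ->] -> ->.
  by exists i, j, k; rewrite mulgA.
have zx := cz x; have zy := cz y.
case: m m3 yx => [|[|[|m]]] // _ yx.
- exists false, d; have surjy := surj y (erefl _).
  exact: (@nc_coded false d x y z (expE z Ez) (expE y Ey) x3 yx zx zy surjy).
- exists true, d; have surjy := surj y (erefl _).
  exact: (@nc_coded true d x y z (expE z Ez) (expE y Ey) x3 yx zx zy surjy).
(* For [y, x] = z^2, replacing [y] by its inverse turns the commutator into [z]. *)
exists true, d.
apply: (@nc_coded true d x y^-1 z (expE z Ez) (expE y^-1 _) x3 _ zx _ (surj _ _)).
- by rewrite groupV.
- have zy2 : z ^+ 2 * y^-1 = y^-1 * z ^+ 2 by apply: (commuteX2 2 1 (cz y^-1)).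
  apply: (mulgI y); rewrite mulKVg !mulgA yx -(mulgA (x * y)) zy2 !mulgA mulgK.
  by rewrite -!mulgA (expE z Ez : z * (z * z ^+ true) = 1) mulg1.
- exact: cz.
- exact: cycleV.
Qed.

End Order27.

(** * Cospectral pairs *)

Definition walk_step (D : seq (seq nat)) (b : seq bool) (v : seq N) : seq N :=
  [seq foldr (fun cx acc => if nth false b cx.1 then N.add cx.2 acc else acc) N0
         (zip r v) | r <- D].

Definition walk_vec D b k := iter k (walk_step D b) (Npos xH :: nseq 26 N0).

Definition dotN (q : seq N) (ws : seq (seq N)) n : N :=
  foldr (fun cw acc => N.add (N.mul cw.1 (nth N0 cw.2 n)) acc) N0 (zip q ws).

(* The polynomial with coefficients [qp - qm] annihilates the adjacency matrix. *)
Definition annihilates D b qp qm :=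
  let ws := traject (walk_step D b) (Npos xH :: nseq 26 N0) (size qp) in
  all (fun n => N.eqb (dotN qp ws n) (dotN qm ws n)) elts.

Lemma size_walk_vec D b k : size D = 27 -> size (walk_vec D b k) = 27.
Proof. by case: k => [|k] // D27; rewrite size_map. Qed.

Section WalkVec.

Variables (gT : finGroupType) (op : nat -> nat -> nat) (phi : nat -> gT).
Variable S : {set gT}.
Hypotheses (cod : coded op phi) (val : valid_op op) (conS : connection_set S).

Local Notation D := (diff_table op).
Local Notation b := (bits op phi S).

Lemma size_diff : size D = 27.
Proof. by rewrite size_map size_iota. Qed.

Lemma walk_vecE k n : n < 27 ->
  N.to_nat (nth N0 (walk_vec D b k) n) = walks (Cay S) k (phi n) 1%g.
Proof.
elim: k n => [|k IH] n n27.
  rewrite /walks -(coded1 cod val).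
  have -> : (phi n == phi 0) = (n == 0).
    by apply/eqP/eqP => [/(coded_inj cod)->|->] //; rewrite inE.
  case: n n27 => [//|n] n27.
  by rewrite -[nth _ _ _]/(nth N0 (nseq 26 N0) n) nth_nseq if_same.
rewrite /walk_vec iterS -/(walk_vec D b k) (nth_map [::]) ?size_diff //.
rewrite -add1n walksD (sum_coded cod).
have szr : size (nth [::] D n) = 27.
  by rewrite (nth_map 0) ?size_iota // size_map size_map.
have szv := size_walk_vec b k size_diff.
under eq_big_seq => z zin.
  have z27 : z < 27 by rewrite mem_iota in zin.
  rewrite walks1 (Cay_adj cod val conS n27 z27) /adj -IH //.
  over.
move: (walk_vec _ _ _) (nth [::] D n) szv szr => v r szv szr.
rewrite /elts -[in iota 0 27]szr.
elim: r v {szr szv IH} (etrans szr (esym szv)) => [|x r IH] [|y v] //=.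
  by rewrite big_nil.
move=> [szrv]; rewrite big_cons /= (iotaDl 1 0) big_map /= -IH //.
by case: ifP => _; rewrite ?mul0n // N2Nat.inj_add mul1n.
Qed.

Lemma walk_vec1 k :
  N.to_nat (nth N0 (walk_vec D b k) 0) = walks (Cay S) k 1%g 1%g.
Proof. by rewrite (walk_vecE k (isT : 0 < 27)) (coded1 cod val). Qed.

Lemma dotNE q ws n : size q = size ws ->
  N.to_nat (dotN q ws n)
  = \sum_(k < size q) N.to_nat (nth N0 q k) * N.to_nat (nth N0 (nth [::] ws k) n).
Proof.
elim: q ws => [|c q IH] [|w ws] //=; first by rewrite big_ord0.
by move=> [sz]; rewrite big_ord_recl /= N2Nat.inj_add N2Nat.inj_mul IH.
Qed.

(** Only the column of the identity is tested; translation invariance carries the relation to every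
    entry. *)
Lemma annihilatesP qp qm (q : {poly algC} := (\poly_(k < size qp)
      ((N.to_nat (nth N0 qp k))%:R - (N.to_nat (nth N0 qm k))%:R))%R) :
  size qm = size qp -> annihilates D b qp qm ->
  forall x y, (\sum_(k < size qp) q`_k * (walks (Cay S) k x y)%:R = 0)%R.
Proof.
move=> szq /allP ann x y; have [n n27 xyE] := coded_surj cod (x * y^-1)%g.
have := ann n; rewrite mem_iota => /(_ n27)/N.eqb_eq/(congr1 N.to_nat).
rewrite !dotNE ?size_traject // szq => /(congr1 (fun m => m%:R : algC)%R)/eqP.
rewrite -subr_eq0 !natr_sum -sumrB => /eqP sum0; rewrite -[RHS]sum0.
apply: eq_bigr => k _.
rewrite coef_poly ltn_ord !natrM -mulrBl walks_Cay1 -xyE; congr (_ * _%:R)%R.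
rewrite (set_nth_default (Npos xH :: nseq 26 N0)) ?size_traject ?ltn_ord //.
by rewrite nth_traject ?ltn_ord // -(walk_vecE _ n27).
Qed.

End WalkVec.

Lemma cospectral_certificate (gT hT : finGroupType) op op' phi psi
    (S : {set gT}) (S' : {set hT}) qp qm :
    coded op phi -> valid_op op -> connection_set S ->
    coded op' psi -> valid_op op' -> connection_set S' ->
    size qm = size qp -> 0 < size qp ->
    nth N0 qp (size qp).-1 = Npos xH -> nth N0 qm (size qp).-1 = N0 ->
    annihilates (diff_table op) (bits op phi S) qp qm ->
    annihilates (diff_table op') (bits op' psi S') qp qm ->
    all (fun k => nth N0 (walk_vec (diff_table op) (bits op phi S) k) 0
      == nth N0 (walk_vec (diff_table op') (bits op' psi S') k) 0) (iota 0 (size qp)) ->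
  cospectral (Cay S) (Cay S').
Proof.
move=> cod val conS cod' val' conS' szq q0 qp1 qm0 ann ann' /allP wS.
pose q : {poly algC} := (\poly_(k < size qp)
  ((N.to_nat (nth N0 qp k))%:R - (N.to_nat (nth N0 qm k))%:R))%R.
have sq : size q = size qp.
  by rewrite size_poly_eq // qp1 qm0 subr0 oner_neq0.
apply: (@walks_cospectral _ _ _ _ q).
- by rewrite -size_poly_gt0 sq.
- by rewrite (coded_card cod).
- by rewrite (coded_card cod) (coded_card cod').
- by rewrite sq; apply: (annihilatesP cod val conS szq ann).
- by rewrite sq; apply: (annihilatesP cod' val' conS' szq ann').
move=> k; rewrite sq => kq; rewrite !sum_walks_Cay (coded_card cod) (coded_card cod').
rewrite -(walk_vec1 cod val conS k) -(walk_vec1 cod' val' conS' k).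
have kin : k \in iota 0 (size qp) by rewrite mem_iota.
exact: (congr1 (fun w => 27 * N.to_nat w) (eqP (wS k kin))).
Qed.

(** An isomorphism preserves walk numbers, and by translation each of them already occurs between
    some vertex and the identity. *)
Lemma noniso_certificate (gT hT : finGroupType) op op' phi psi
    (S : {set gT}) (S' : {set hT}) k n :
    coded op phi -> valid_op op -> connection_set S ->
    coded op' psi -> valid_op op' -> connection_set S' -> n < 27 ->
    nth N0 (walk_vec (diff_table op) (bits op phi S) k) n
      \notin walk_vec (diff_table op') (bits op' psi S') k ->
  ~ graph_iso (Cay S) (Cay S').
Proof.
move=> cod val conS cod' val' conS' n27 notin [f bf fE].
have := walks_bij k (phi n) 1%g bf fE; rewrite walks_Cay1.
have [m m27 <-] := coded_surj cod' (f (phi n) * (f 1)^-1)%g.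
rewrite -(walk_vecE cod val conS) // -(walk_vecE cod' val' conS') // => /N2Nat.inj eqn.
by case/negP: notin; rewrite -eqn mem_nth // size_walk_vec ?size_diff.
Qed.

Definition sym_bits op (s : seq nat) :=
  [seq (r \in s) || (op_inv op r \in s) | r <- reps op].

Definition pair_test op op' b b' qp qm k :=
  let D := diff_table op in let D' := diff_table op' in
  [&& [&& valid_op op, valid_op op', size b == 13 & size b' == 13],
      [&& size qm == size qp, 0 < size qp, nth N0 qp (size qp).-1 == Npos xH
        & nth N0 qm (size qp).-1 == N0],
      annihilates D b qp qm, annihilates D' b' qp qm
    & all (fun k => nth N0 (walk_vec D b k) 0 == nth N0 (walk_vec D' b' k) 0)
        (iota 0 (size qp))
      && has (fun w => w \notin walk_vec D' b' k) (walk_vec D b k)].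

Lemma pair_test_not_CayDS (gT hT : finGroupType) op op' (phi : nat -> gT)
    (psi : nat -> hT) b b' qp qm k :
  coded op phi -> coded op' psi -> pair_test op op' b b' qp qm k -> ~ CayDS gT.
Proof.
move=> cod cod' /and5P[/and4P[val val' /eqP b13 /eqP b13']].
move=> /and4P[/eqP szq q0 /eqP qp1 /eqP qm0] ann ann' /andP[wS /hasP[w /(nthP N0)[n]]].
rewrite size_walk_vec ?size_diff // => n27 <- noniso DS.
have conS := bset_connection cod val b13; have conS' := bset_connection cod' val' b13'.
have bE := bsetK cod val b13; have bE' := bsetK cod' val' b13'.
rewrite -bE in ann wS noniso; rewrite -bE' in ann' wS noniso.
apply: (noniso_certificate cod val conS cod' val' conS' n27 noniso).
apply: (DS _ conS _ _ conS').
exact: (cospectral_certificate cod val conS cod' val' conS' szq q0 qp1 qm0 ann ann' wS).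
Qed.

(** A concrete nonabelian group of order 27 and exponent 9, to carry the mates of graphs on C3^3 and
    on the Heisenberg group. *)
Definition M27 : Type := 'I_27.
HB.instance Definition _ := Finite.copy M27 'I_27.

Definition M27_mul (a b : M27) : M27 := inord (nc_op true true a b).
Definition M27_inv (a : M27) : M27 := inord (op_inv (nc_op true true) a).

Lemma val_M27_mul a b : M27_mul a b = nc_op true true a b :> nat.
Proof. by rewrite inordK // (op_lt (valid_nc true true)) ?ltn_ord. Qed.

Lemma M27_mulA : associative M27_mul.
Proof.
have: all (fun a => all (fun b => all (fun c =>
    nc_op true true a (nc_op true true b c) == nc_op true true (nc_op true true a b) c)
    elts) elts) elts by vm_compute.
move=> /allP h a b c; apply: val_inj; rewrite /= !val_M27_mul; apply/eqP.
have [ain bin cin] : [/\ (a : nat) \in elts, (b : nat) \in elts & (c : nat) \in elts].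
  by rewrite !mem_iota !ltn_ord.
exact: (allP (allP (h a ain) b bin) c cin).
Qed.

Lemma M27_mul1 : left_id (inord 0 : M27) M27_mul.
Proof.
have: all (fun a => nc_op true true 0 a == a) elts by vm_compute.
move=> /allP h a; apply: val_inj; rewrite /= val_M27_mul inordK //; apply/eqP.
by apply: h; rewrite mem_iota ltn_ord.
Qed.

Lemma M27_mulV : left_inverse (inord 0 : M27) M27_inv M27_mul.
Proof.
have: all (fun a => (op_inv (nc_op true true) a < 27) &&
    (nc_op true true (op_inv (nc_op true true) a) a == 0)) elts by vm_compute.
move=> /allP h a; apply: val_inj; rewrite /= val_M27_mul.
have ain : (a : nat) \in elts by rewrite mem_iota ltn_ord.
have /andP[i27 /eqP iE] := h a ain.
by rewrite !inordK // iE.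
Qed.

HB.instance Definition _ := Finite_isGroup.Build M27 M27_mulA M27_mul1 M27_mulV.

Lemma M27_coded : coded (nc_op true true) (fun n => inord n : M27).
Proof.
split=> [|a|a b a27 b27]; first by rewrite card_ord.
  by exists (a : nat); rewrite ?ltn_ord //; apply: val_inj; rewrite /= inordK.
apply: val_inj; rewrite /= val_M27_mul !inordK //.
by rewrite (op_lt (valid_nc true true)).
Qed.

(** Positive and negative parts, lowest degree first, of X (X - 3) (X + 3) (X - 6), whose roots are
    the eigenvalues of H(3, 3). The degree 10 polynomial below plays the same role on C9 x C3 and
    has the valency 10 as a root. *)
Definition quartic_pos : seq N := [:: 0; 54; 0; 0; 1]%num.
Definition quartic_neg : seq N := [:: 0; 0; 9; 6; 0]%num.
Definition decic_pos : seq N := [:: 0; 0; 13104; 8472; 0; 0; 1107; 252; 0; 0; 1]%num.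
Definition decic_neg : seq N := [:: 3200; 5920; 0; 0; 6672; 2700; 0; 0; 63; 7; 0]%num.

(* The Hamming graph H(3, 3) is the Cayley graph of {x, y, z} in C3^3 and of  *)
(* {xz, xy, xy^2} in [M27]; it is cospectral with those of {yz, x, xy} in the *)
(* Heisenberg group and {x, xy, xy^2} in [M27], in which two vertices at      *)
(* distance 2 may have 3 common neighbours.                                   *)
Lemma nc_not_CayDS (gT : finGroupType) c d (phi : nat -> gT) :
  coded (nc_op c d) phi -> ~ CayDS gT.
Proof.
pose M_Hamming := sym_bits (nc_op true true) [:: 10; 4; 7].
pose M_mate := sym_bits (nc_op true true) [:: 1; 4; 7].
case: c d => [] [] cod.
- apply: (@pair_test_not_CayDS _ _ _ _ _ _ M_mate M_Hamming
    quartic_pos quartic_neg 2 cod cod).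
  by vm_compute.
- apply: (@pair_test_not_CayDS _ _ _ _ _ _
    (sym_bits (nc_op true false) [:: 12; 1; 4]) M_Hamming
    quartic_pos quartic_neg 2 cod M27_coded).
  by vm_compute.
- apply: (@pair_test_not_CayDS _ _ _ _ _ _
    (sym_bits (nc_op false true) [:: 3; 12; 21; 1; 4])
    (sym_bits (nc_op false true) [:: 1; 10; 19; 4; 7])
    decic_pos decic_neg 3 cod cod).
  by vm_compute.
- apply: (@pair_test_not_CayDS _ _ _ _ _ _
    (sym_bits (nc_op false false) [:: 1; 3; 9]) M_mate
    quartic_pos quartic_neg 2 cod M27_coded).
  by vm_compute.
Qed.

Theorem theorem4p4 (gT : finGroupType) (hG : #|[set: gT]| = 27) :
  CayDS gT <-> [set: gT] \isog Zp 27.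
Proof.
have cG : #|gT| = 27 by rewrite -cardsT.
have cycZ : cyclic (Zp 27) by apply/cyclicP; exists Zp1; apply: Zp_cycle.
rewrite isog_sym isog_cyclic_card // hG card_Zp // eqxx andbT; split=> [DS|].
  apply: contraT => /(noncyclic_coded cG)[c [d [phi cod]]].
  by case: (nc_not_CayDS cod DS).
case/(cyclic_coded cG) => phi cod S conS hT S' conS' cosp.
have cH : #|hT| = 27 by rewrite -(cospectral_card cosp).
apply: (C27_CayDS cod conS conS' _ cosp).
have [cyc|ncyc] := boolP (cyclic [set: hT]).
  by left; apply: cyclic_coded.
by right; apply: noncyclic_coded.
Qed.
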